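(* Let $R$ be a regular FDZ-algebra. Then for any FDZ-algebra $S$, $$R\equiv S\iff R\cong S,$$ where $\equiv$ denotes elementary equivalence in the language $L$ of pure rings.
   Context: A ring is an abelian group equipped with a $\mathbb{Z}$-bilinear binary operation (not necessarily associative, commutative or unital). An FDZ-algebra is a ring whose additive group is finitely generated as an abelian group. $L$ is the first-order language of pure rings, with signature $\langle+,\cdot,0\rangle$. For a ring $R$: $Ann(R)=\{x\in R: xy=yx=0\ \text{for all } y\in R\}$; $R^2$ is the ideal of $R$ generated by all products $xy$, $x,y\in R$; for an ideal $I$, $Is(I)=\{x\in R: ax\in I\text{ for some }a\in\mathbb{Z}\setminus\{0\}\}$. For an FDZ-algebra $R$, an addition $R_0$ of $R$ is a direct complement of $Is(R^2)\cap Ann(R)$ in $Ann(R)$; it is an ideal of $R$. An FDZ-algebra $R$ is called regular if for some addition (and therefore for any addition) $R_0$ there exists a subring $R_F$ of $R$ containing $R^2$ such that $R\cong R_F\times R_0$. *)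

(* Defs.v *)
From HB Require Import structures.
From mathcomp Require Import all_boot all_order all_algebra.
From mathcomp Require Import boolp classical_sets.

Set Implicit Arguments.
Unset Strict Implicit.
Unset Printing Implicit Defensive.

Import GRing.Theory.

Local Open Scope ring_scope.
Local Open Scope classical_set_scope.

(* Rings that need not be associative, commutative or unital. The product is
   the magma operation [(x * y)%g]; [(x * y)%R] would require the unital
   associative rings of ssralg. Additivity in each argument is
   Z-bilinearity. *)
HB.mixin Record Zmodule_Magma_isNARing R of GRing.Zmodule R & Magma R := {
  namulDl : left_distributive ( *%g : R -> R -> R) +%R;
  namulDr : right_distributive ( *%g : R -> R -> R) +%R
}.

#[short(type="naRingType")]
HB.structure Definition NARing :=
  {R of GRing.Zmodule R & Magma R & Zmodule_Magma_isNARing R}.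

Definition na_isomorphic (R S : naRingType) : Prop :=
  exists f : {additive R -> S}, {morph f : x y / (x * y)%g} /\ bijective f.

Section PairNARing.
Variables R S : naRingType.

Fact pair_namulDl : left_distributive ( *%g : R * S -> _ -> _) +%R.
Proof. by move=> x y z; congr pair; apply: namulDl. Qed.

Fact pair_namulDr : right_distributive ( *%g : R * S -> _ -> _) +%R.
Proof. by move=> x y z; congr pair; apply: namulDr. Qed.

HB.instance Definition _ :=
  Zmodule_Magma_isNARing.Build (R * S)%type pair_namulDl pair_namulDr.
End PairNARing.

Record subring (R : naRingType) := Subring {
  subring_set :> set R;
  subring_zmod : zmod_closed [in subring_set];
  subring_mulg : mulg_closed [in subring_set]
}.

Definition subring_type (R : naRingType) (A : subring R) : Type :=
  {x : R | x \in subring_set A}.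

Section SubringType.
Variables (R : naRingType) (A : subring R).

HB.instance Definition _ := [isSub of subring_type A for @sval R _].
HB.instance Definition _ := [Choice of subring_type A by <:].
HB.instance Definition _ :=
  GRing.SubChoice_isSubZmodule.Build R _ (subring_type A) (subring_zmod A).
HB.instance Definition _ :=
  SubChoice_isSubMagma.Build R _ (subring_type A) (@subring_mulg R A).

Fact subring_valD : {morph (val : subring_type A -> R) : x y / x + y}.
Proof. exact: GRing.valD. Qed.

Fact subring_valM : {morph (val : subring_type A -> R) : x y / (x * y)%g}.
Proof. exact: valM. Qed.

Fact subring_namulDl : left_distributive ( *%g : subring_type A -> _ -> _) +%R.
Proof.
by move=> x y z; apply: val_inj; rewrite !(subring_valM, subring_valD) namulDl.
Qed.

Fact subring_namulDr : right_distributive ( *%g : subring_type A -> _ -> _) +%R.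
Proof.
by move=> x y z; apply: val_inj; rewrite !(subring_valM, subring_valD) namulDr.
Qed.

HB.instance Definition _ :=
  Zmodule_Magma_isNARing.Build (subring_type A) subring_namulDl subring_namulDr.
End SubringType.

Section FDZ.
Variable R : naRingType.
Implicit Types (A I : set R).

Definition is_FDZ : Prop :=
  exists m (s : m.-tuple R), forall x : R, inIntSpan s x.

Definition is_ideal I : Prop :=
  zmod_closed [in I] /\
  forall x y : R, I x -> I (x * y)%g /\ I (y * x)%g.

Definition Ann : set R :=
  [set x | forall y : R, (x * y)%g = 0 /\ (y * x)%g = 0].

Definition Rsquare : set R :=
  smallest is_ideal [set (x * y)%g | x in [set: R] & y in [set: R]].

Definition Is I : set R :=
  [set x | exists2 a : int, a != 0 & I (x *~ a)].

Definition is_addition A : Prop :=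
  [/\ zmod_closed [in A],
      A `<=` Ann,
      A `&` (Is Rsquare `&` Ann) = [set 0]
    & forall x, Ann x ->
        exists y z, [/\ A y, (Is Rsquare `&` Ann) z & x = y + z]].

(* The isomorphism is only required to exist abstractly; it need not be induced
   by the inclusions of [RF] and [R0] in [R]. *)
Definition is_regular : Prop :=
  exists R0 RF : subring R,
    [/\ is_addition R0,
        Rsquare `<=` RF
      & na_isomorphic R (subring_type RF * subring_type R0)%type].
End FDZ.

Inductive term : Type :=
| Var of nat
| Zero
| Add of term & term
| Mul of term & term.

Inductive formula : Type :=
| Eq of term & term
| Bot
| Not of formula
| And of formula & formula
| Or of formula & formula
| Imp of formula & formula
| Forall of nat & formula
| Exists of nat & formula.

Fixpoint term_fv (t : term) : seq nat :=
  match t with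
  | Var i => [:: i]
  | Zero => [::]
  | Add t1 t2 | Mul t1 t2 => term_fv t1 ++ term_fv t2
  end.

Fixpoint formula_fv (f : formula) : seq nat :=
  match f with
  | Eq t1 t2 => term_fv t1 ++ term_fv t2
  | Bot => [::]
  | Not f1 => formula_fv f1
  | And f1 f2 | Or f1 f2 | Imp f1 f2 => formula_fv f1 ++ formula_fv f2
  | Forall i f1 | Exists i f1 => [seq j <- formula_fv f1 | j != i]
  end.

Definition sentence (f : formula) : Prop := formula_fv f = [::].

Section Semantics.
Variable R : naRingType.

Fixpoint eval (e : nat -> R) (t : term) : R :=
  match t with
  | Var i => e i
  | Zero => 0
  | Add t1 t2 => eval e t1 + eval e t2
  | Mul t1 t2 => (eval e t1 * eval e t2)%g
  end.

Fixpoint holds (e : nat -> R) (f : formula) : Prop :=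
  match f with
  | Eq t1 t2 => eval e t1 = eval e t2
  | Bot => False
  | Not f1 => ~ holds e f1
  | And f1 f2 => holds e f1 /\ holds e f2
  | Or f1 f2 => holds e f1 \/ holds e f2
  | Imp f1 f2 => holds e f1 -> holds e f2
  | Forall i f1 => forall x : R, holds [eta e with i |-> x] f1
  | Exists i f1 => exists x : R, holds [eta e with i |-> x] f1
  end.

(* The assignment is irrelevant on sentences. *)
Definition models (f : formula) : Prop := holds (fun=> 0) f.
End Semantics.

Definition elem_equiv (R S : naRingType) : Prop :=
  forall f : formula, sentence f -> (models R f <-> models S f).

(* Main.v *)
Require Import Defs.
From HB Require Import structures.
From mathcomp Require Import all_boot all_order all_algebra all_field.
From mathcomp Require Import boolp classical_sets.

Set Implicit Arguments.
Unset Strict Implicit.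
Unset Printing Implicit Defensive.

Import Order.TTheory GRing.Theory Num.Theory.

Local Open Scope ring_scope.

(** An isomorphism preserves the truth of every formula ([iso_elem_equiv]). For
    the converse let [R] and [S] be elementarily equivalent, with finitely
    generated additive groups.

    A first-order sentence can say that some tuple of [S] satisfies a finite
    presentation of [R], generates [S] modulo a given integer [N], and has any
    given first-order property of a tuple of [R]. So each such property is
    carried over by a homomorphism [phi : R -> S] whose image has finite index
    ([elem_equiv_transfer]); another one, [psi : S -> R], goes back, and [psi \o
    phi] is an endomorphism [rho] of [R] of finite index that preserves a
    property chosen in advance. The integers are in general not definable in
    [R], so nothing forces [rho] to be onto; already the zero ring on the
    integers is isomorphic to proper subrings of finite index. The central point
    is that a suitable property forces [rho] to be onto modulo the annihilator
    ([rigid_tuple]).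

    The role of the integers is taken by a commutative ring of scalars. Modulo
    torsion, [R] divided by its annihilator is a lattice with a nondegenerate
    bilinear form. The endomorphisms that are self-adjoint for this form and
    commute with all self-adjoint ones form a commutative order [P] that
    contains the integers, and the tuples that encode elements of [P] are
    definable ([scalar_codeP]). The property requires that the tuple span the
    lattice over [P], that certain tuples encode elements of [P] (at the start,
    generators of [P]), and that the ideal of [P] generated by certain encoded
    elements (at the start, generators of the nilradical) be semiprime. If [rho]
    preserves it, then conjugation by [rho] maps [P] into itself. Modulo the
    nilradical it is onto, because an element has the same characteristic
    polynomial as all its images, and simultaneous triangularisation leaves only
    finitely many possibilities modulo nilpotents. The images of generators of
    the nilradical generate it again, so conjugation maps [P] onto [P]
    ([conjugation_onto]). As the image of the tuple still spans the lattice over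
    [P], the lattice is the image of [rho].

    Hence [phi] is injective and [S] is the sum of its image and the annihilator
    ([elem_equiv_embedding]). Regularity splits [R] into a subring [F] that
    contains the square and a free zero ring, such that annihilating elements of
    [F] have nonzero integer multiples in the square ([regular_split]). One more
    first-order property makes [S] modulo the image of [F] torsion-free, hence
    free. Then [S] too splits into the image of [F] and a free zero ring, the
    ranks of the two zero rings agree, and the rings are isomorphic
    ([regular_elem_equiv_iso]). *)

(** * Subgroups of finitely generated abelian groups *)

Definition lincomb (V : zmodType) m (g : 'I_m -> V) (c : 'rV[int]_m) : V :=
  \sum_i g i *~ c 0 i.

Definition subgroup (V : zmodType) (D : V -> Prop) : Prop :=
  D 0 /\ forall x y, D x -> D y -> D (x - y).

Definition fin_gen (V : zmodType) (D : V -> Prop) : Prop :=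
  exists m (g : 'I_m -> V),
    (forall i, D (g i)) /\ forall x, D x -> exists c, x = lincomb g c.

Section LinComb.
Variables (V : zmodType).

Fact lincomb_is_zmod_morphism m (g : 'I_m -> V) : zmod_morphism (lincomb g).
Proof.
move=> c d; rewrite /lincomb -sumrB; apply: eq_bigr => i _.
by rewrite !mxE mulrzBr.
Qed.

HB.instance Definition _ m (g : 'I_m -> V) :=
  GRing.isZmodMorphism.Build 'rV[int]_m V (lincomb g)
    (lincomb_is_zmod_morphism g).

Lemma lincombZ m (g : 'I_m -> V) a c : lincomb g (a *: c) = lincomb g c *~ a.
Proof.
rewrite /lincomb mulrz_suml; apply: eq_bigr => i _.
by rewrite mxE mulrC mulrzA.
Qed.

Lemma lincomb_delta m (g : 'I_m -> V) i : lincomb g (delta_mx 0 i) = g i.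
Proof.
rewrite /lincomb (bigD1 i) //= big1 => [|j nji].
  by rewrite mxE !eqxx addr0.
by rewrite mxE eqxx (negbTE nji) mulr0z.
Qed.

Lemma lincombM m n (g : 'I_n -> V) c (A : 'M_(m, n)) :
  lincomb g (c *m A) = lincomb (fun i => lincomb g (row i A)) c.
Proof.
rewrite mulmx_sum_row raddf_sum; apply: eq_bigr => i _.
exact: lincombZ.
Qed.

Lemma raddf_lincomb (W : zmodType) (h : {additive V -> W}) m (g : 'I_m -> V) c :
  h (lincomb g c) = lincomb (h \o g) c.
Proof. by rewrite raddf_sum; apply: eq_bigr => i _; rewrite raddfMz. Qed.

Lemma eq_lincomb m (g h : 'I_m -> V) c : g =1 h -> lincomb g c = lincomb h c.
Proof. by move=> e; apply: eq_bigr => i _; rewrite e. Qed.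

Lemma lincomb_recl m (g : 'I_m.+1 -> V) c :
  lincomb g c = g ord0 *~ c 0 ord0 +
     lincomb (g \o lift ord0) (\row_i c 0 (lift ord0 i)).
Proof.
rewrite /lincomb big_ord_recl; congr (_ + _).
by apply: eq_bigr => i _; rewrite mxE.
Qed.

End LinComb.

Section Subgroup.
Variables (V : zmodType) (D : V -> Prop) (sD : subgroup D).

Lemma subgroupN x : D x -> D (- x).
Proof. by move=> Dx; rewrite -[- x]add0r; apply: sD.2 => //; apply: sD.1. Qed.

Lemma subgroupD x y : D x -> D y -> D (x + y).
Proof.
by move=> Dx Dy; rewrite -[y]opprK; apply: sD.2 => //; apply: subgroupN.
Qed.

Lemma subgroup_sum I r (P : pred I) F :
  (forall i, P i -> D (F i)) -> D (\sum_(i <- r | P i) F i).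
Proof. by move=> DF; apply: big_ind => //; [apply: sD.1|apply: subgroupD]. Qed.

Lemma subgroupMn x n : D x -> D (x *+ n).
Proof.
by move=> Dx; elim: n => [|n IH]; rewrite ?mulr0n ?mulrS;
   [apply: sD.1 | apply: subgroupD].
Qed.

Lemma subgroupMz x a : D x -> D (x *~ a).
Proof.
by case: a => n Dx; rewrite -?pmulrn ?NegzE -?nmulrn;
  [|apply: subgroupN]; apply: subgroupMn.
Qed.

Lemma subgroup_lincomb m (g : 'I_m -> V) c :
  (forall i, D (g i)) -> D (lincomb g c).
Proof. by move=> Dg; apply: subgroup_sum => i _; apply: subgroupMz. Qed.

Lemma subgroupDr x y : D y -> D (x + y) <-> D x.
Proof.
move=> Dy; split=> [Dxy|Dx]; last exact: subgroupD.
by rewrite -(addrK y x); apply: sD.2.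
Qed.
End Subgroup.

Lemma subgroup_int (I : int -> Prop) : subgroup I ->
  exists2 d, I d & forall a, I a -> exists b, a = b * d.
Proof.
move=> sI; have [[n [n0 In]]|noI] := pselect (exists n : nat, (0 < n)%N /\ I n).
  have ex : exists n : nat, (0 < n)%N && `[< I n >].
    by exists n; rewrite n0; apply/asboolP.
  case: (ex_minnP ex) => d /andP[d0 /asboolP Id] dmin; exists d%:Z => // a Ia.
  exists (a %/ d)%Z; rewrite {1}(divz_eq a d).
  suff -> : (a %% d)%Z = 0 by rewrite addr0.
  have Ir : I (a %% d)%Z.
    rewrite /modz; apply: sI.2 => //.
    by rewrite mulrC -mulrzz; apply: subgroupMz.
  have r0 : 0 <= (a %% d)%Z by rewrite modz_ge0 // (lt0r_neq0 (d0 : 0 < d%:Z)).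
  have rd : (a %% d)%Z < d by rewrite ltz_pmod.
  case: (a %% d)%Z Ir r0 rd => // r Ir _ rd; congr Posz.
  apply/eqP; rewrite -leqn0 leqNgt; apply/negP => r0.
  have := dmin r; rewrite r0 /= => /(_ (introT (asboolP _) Ir)).
  by rewrite leqNgt (rd : (r < d)%N).
exists 0; first exact: sI.1.
move=> a Ia; exists 0; rewrite mulr0.
have [a0|a0] := leP 0 a.
  case: a a0 Ia => // -[//|n] _ In; case: noI; exists n.+1; split => //.
have : I (- a) by apply: subgroupN.
case: (- a) (a0) (oppr_gt0 a) => [[|n]|n]; rewrite ?a0 //.
by move=> _ _ In; case: noI; exists n.+1.
Qed.

Section FinGen.
Variable V : zmodType.
Implicit Types D : V -> Prop.

(** The standard proof that Z is noetherian: splitting off one generator, the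
    coefficients that occur at it form a subgroup of Z, which is principal. *)
Lemma fin_gen_sub m (g : 'I_m -> V) D : subgroup D ->
  (forall x, D x -> exists c, x = lincomb g c) -> fin_gen D.
Proof.
elim: m g D => [|m IH] g D sD Dg.
  exists 0%N, g; split=> [[]//|x /Dg].
  by [].
pose g' := g \o lift ord0.
pose I a := exists c, D (g ord0 *~ a + lincomb g' c).
have sI : subgroup I.
  split; first by exists 0; rewrite mulr0z raddf0 addr0; apply: sD.1.
  move=> a b [c Dc] [d Dd]; exists (c - d).
  by rewrite mulrzBr raddfB addrACA -opprD; apply: sD.2.
have [a0 [c0 Dx0] Ia0] := subgroup_int sI.
set x0 := _ + _ in Dx0.
pose D' x := D x /\ exists c, x = lincomb g' c.
have [||q [h [D'h genh]]] := IH g' D'.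
- split; first by split; [exact: sD.1 | exists 0; rewrite raddf0].
  move=> x y [Dx [c xE]] [Dy [d yE]]; split; first exact: sD.2.
  by exists (c - d); rewrite raddfB xE yE.
- by move=> x [].
exists q.+1, (fun i => oapp h x0 (unlift ord0 i)); split=> [i|x Dx].
  by case: (unlift ord0 i) => //= j; case: (D'h j).
have [c xE] := Dg _ Dx.
rewrite lincomb_recl in xE.
have [|b bE] := Ia0 (c 0 ord0).
  by exists (\row_i c 0 (lift ord0 i)); rewrite -xE.
have [|d dE] := genh (x - x0 *~ b).
  split; first by apply: sD.2 => //; apply: subgroupMz.
  exists (\row_i c 0 (lift ord0 i) - b *: c0).
  rewrite raddfB /= lincombZ /x0 mulrzDl -mulrzA mulrC -bE xE opprD addrACA.
  by rewrite subrr add0r.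
exists (\row_i oapp (d 0) b (unlift ord0 i)).
rewrite lincomb_recl mxE unlift_none /=.
rewrite (eq_lincomb (h := h)) => [|i]; last by rewrite /= liftK.
rewrite (_ : \row__ _ = d) -?dE ?subrKC //.
by apply/rowP => i; rewrite !mxE liftK.
Qed.

Lemma fin_gen_subgroup D E : subgroup D -> fin_gen E ->
  (forall x, D x -> E x) -> fin_gen D.
Proof.
by move=> sD [m [g [_ gE]]] sDE; apply: (@fin_gen_sub m g) => // x /sDE/gE.
Qed.

(** Scaling the finitely many generators by a common multiple of their orders
    modulo [E] moves all of [D] into [E]. *)
Lemma torsion_exponent D E : subgroup E -> fin_gen D ->
  (forall x, D x -> exists2 a : int, a != 0 & E (x *~ a)) ->
  exists2 b, (0 < b)%N & forall x, D x -> E (x *+ b).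
Proof.
move=> sE [m [g [Dg gD]]] tor.
have /choice[a Ea] : forall i, exists b : nat, (0 < b)%N /\ E (g i *+ b).
  move=> i; have [a a0 Ea] := tor _ (Dg i).
  exists `|a|%N; split; first by rewrite absz_gt0.
  case: a a0 Ea => [] n; rewrite -?pmulrn // NegzE mulrNz => _ /(subgroupN sE).
  by rewrite opprK -pmulrn.
exists (\prod_i a i)%N; first by rewrite prodn_gt0 // => i; case: (Ea i).
move=> x /gD[c ->]; rewrite pmulrn mulrz_suml /=.
apply: subgroup_sum => // i _.
rewrite -mulrzA mulrC mulrzA -pmulrn (bigD1 i) //= mulrnA.
by apply: subgroupMz => //; apply: subgroupMn => //; case: (Ea i).
Qed.

Lemma finite_mod D N : subgroup D -> fin_gen D -> (0 < N)%N ->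
  exists w (h : 'I_w -> V), (forall i, D (h i)) /\
    forall x, D x -> exists i z, D z /\ x = h i + z *+ N.
Proof.
move=> sD [m [g [Dg gD]]] N0.
pose F := {ffun 'I_m -> 'I_N}.
pose h (i : 'I_#|F|) := lincomb g (\row_j (enum_val i j : nat)%:Z).
exists #|F|, h; split=> [i|x /gD[c ->]]; first exact: subgroup_lincomb.
have rN j : (`|(c 0%R j %% N)%Z| < N)%N.
  have := ltz_pmod (c 0 j) (N0 : 0 < N%:Z).
  have := modz_ge0 (c 0 j) (lt0r_neq0 (N0 : 0 < N%:Z)).
  by case: (c 0%R j %% N)%Z.
exists (enum_rank [ffun j => Ordinal (rN j)]),
  (lincomb g (\row_j (c 0%R j %/ N)%Z)); split; first exact: subgroup_lincomb.
rewrite /h enum_rankK [_ *+ N]pmulrn -lincombZ -raddfD; congr lincomb.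
apply/rowP => j; rewrite !mxE ffunE /= {1}(divz_eq (c 0 j) N) addrC mulrC.
by rewrite gez0_abs // modz_ge0 // (lt0r_neq0 (N0 : 0 < N%:Z)).
Qed.

Definition fg_group := fin_gen (fun _ : V => True).

(** A torsion-free finitely generated quotient is free: in a generating family
    of least size modulo [L] there is no relation, because the Smith form of a
    relation exhibits a multiple of a member of a basis as an element of [L]. *)
Lemma free_quotient (L : V -> Prop) : fg_group -> subgroup L ->
  (forall x (a : int), a != 0 -> L (x *~ a) -> L x) ->
  exists n (k : {additive V -> 'rV[int]_n}) (b : 'I_n -> V),
    [/\ forall x, L x <-> k x = 0, forall i, k (b i) = delta_mx 0 i
      & forall v, k (lincomb b v) = v].
Proof.
move=> [m [g [_ gV]]] sL isoL.
pose gen n :=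
  `[< exists g : 'I_n -> V, forall x, exists c, L (x - lincomb g c) >].
have exn : exists n, gen n.
  exists m; apply/asboolP; exists g => x; have [//|c ->] := gV x.
  by exists c; rewrite subrr; apply: sL.1.
case: (ex_minnP exn) => n /asboolP[{exn m gV}b bV] nmin {g}.
have indep c : L (lincomb b c) -> c = 0.
  case: n b bV nmin c => [|n] b bV nmin c Lc; first by rewrite thinmx0.
  apply/eqP/negPn/negP => c0.
  have [P _ [U uU [d _ cE]]] := int_Smith_normal_form c.
  pose h i := lincomb b (row i U).
  have Lh : L (h ord0).
    move: c0 Lc; rewrite cE (_ : _ *m (\matrix_(i, j) _) =
      (P 0 0 * d`_0) *: delta_mx 0 ord0).
      rewrite -scalemxAl -rowE lincombZ => nz; apply: isoL.
      by apply: contraNneq nz => ->; rewrite scale0r.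
    apply/rowP => j; rewrite !mxE big_ord1 !mxE eqxx /=.
    by rewrite mulr_natr mulrnAr eq_sym.
  have := nmin n; rewrite ltnn => /(_ _)/negP[]//.
  apply/asboolP; exists (h \o lift ord0) => x; have [c' Lx] := bV x.
  exists (\row_i (c' *m invmx U) 0 (lift ord0 i)).
  have Lch := subgroupN sL (subgroupMz sL ((c' *m invmx U) 0 ord0) Lh).
  rewrite -(subgroupDr sL _ Lch) -addrA -opprD addrC [_ + h ord0 *~ _]addrC.
  by rewrite -lincomb_recl -lincombM mulmxKV // addrC.
have /choice[k kP] : forall x, exists c, L (x - lincomb b c) by [].
have kE x c : L (x - lincomb b c) -> k x = c.
  move=> Lx; apply/eqP; rewrite -subr_eq0; apply/eqP/indep.
  by have := sL.2 _ _ Lx (kP x); rewrite opprB addrC addrA subrK raddfB.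
have k_add : zmod_morphism k.
  move=> x y; apply: kE; rewrite raddfB.
  by have := sL.2 _ _ (kP x) (kP y); rewrite opprD addrACA -opprD.
pose K : {additive V -> 'rV[int]_n} :=
  HB.pack k (GRing.isZmodMorphism.Build V 'rV[int]_n k k_add).
have kb v : k (lincomb b v) = v by apply: kE; rewrite subrr; apply: sL.1.
exists n, K, b; split => //= [x|i]; last by rewrite -{1}lincomb_delta kb.
split=> [Lx|kx]; first by apply: kE; rewrite raddf0 subr0.
by have := kP x; rewrite kx raddf0 subr0.
Qed.

End FinGen.

Definition torsion (V : zmodType) (x : V) :=
  exists2 a : int, a != 0 & x *~ a = 0.

Lemma subgroup0 (V : zmodType) : subgroup (fun x : V => x = 0).
Proof. by split=> // x y -> ->; rewrite subr0. Qed.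

Lemma subgroup_torsion (V : zmodType) : subgroup (@torsion V).
Proof.
split; first by exists 1; rewrite ?mul0rz.
move=> x y [a a0 xa] [b b0 yb]; exists (a * b); first by rewrite mulf_neq0.
by rewrite mulrzBl mulrzA xa mul0rz mulrC mulrzA yb mul0rz subr0.
Qed.

Lemma fin_gen_torsion (V : zmodType) : fg_group V -> fin_gen (@torsion V).
Proof.
by move=> fgV; apply: fin_gen_subgroup fgV _ => //; apply: subgroup_torsion.
Qed.

(** * Maps that are onto modulo an integer *)

Lemma mulmx_det_eq0 m n (A : 'M[int]_(m, n)) (X : 'M_n) :
  \det X != 0 -> A *m X = 0 -> A = 0.
Proof.
move=> X0 AX; have : A *m X *m \adj X = 0 by rewrite AX mul0mx.
rewrite -mulmxA mul_mx_adj mul_mx_scalar => /matrixP H.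
apply/matrixP => i j; have /eqP := H i j; rewrite !mxE mulf_eq0 (negbTE X0).
exact: eqP.
Qed.

Lemma mulmx_det_eq0l m n (A : 'M[int]_(m, n)) (X : 'M_m) :
  \det X != 0 -> X *m A = 0 -> A = 0.
Proof.
move=> X0 /(congr1 trmx); rewrite trmx0 trmx_mul => /mulmx_det_eq0 A0.
by apply: trmx_inj; rewrite A0 ?trmx0 // det_tr.
Qed.



(** A substitute for finite index that a first-order formula can express. *)
Definition onto_mod (V W : zmodType) (N : nat) (h : V -> W) : Prop :=
  forall y, exists x z, y = h x + z *+ N.

Lemma map_intr_inj (C : numDomainType) m n :
  injective (map_mx intr : 'M[int]_(m, n) -> 'M[C]_(m, n)).
Proof.
move=> A B /matrixP AB; apply/matrixP => i j; apply: (@intr_inj C).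
by have := AB i j; rewrite !mxE.
Qed.

(** Modulo [N] the matrix [X] has a left inverse, so its determinant is
    invertible there. *)
Lemma det_onto_mod n (X W Z : 'M[int]_n) N : (1 < N)%N ->
  W *m X = 1%:M + Z *+ N -> \det X != 0.
Proof.
move=> N1 /(congr1 (map_mx (intr : int -> 'Z_N))).
rewrite map_mxM map_mxD map_mx1 raddfMn /= (_ : _ *+ N = 0) ?addr0; last first.
  apply/matrixP => i j.
  by rewrite mulmxnE [RHS]mxE -mulr_natr pchar_Zp // mulr0.
move=> /(congr1 determinant); rewrite det_mulmx det1 !det_map_mx => eq1.
apply: contra_eq_neq eq1 => ->; rewrite rmorph0 mulr0.
by rewrite eq_sym oner_neq0.
Qed.

Lemma onto_mod_comp (U V W : zmodType) N (h : {additive V -> W}) (k : U -> V) :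
  onto_mod N h -> onto_mod N k -> onto_mod N (h \o k).
Proof.
move=> hh kk y; have [x [z ->]] := hh y; have [t [u ->]] := kk x.
by exists t, (h u + z); rewrite /= raddfD raddfMn mulrnDl addrA.
Qed.

Lemma onto_mod_matrix (V : zmodType) n (k : {additive V -> 'rV[int]_n})
    (b : 'I_n -> V) N (h : {additive V -> V}) :
  (forall v, k (lincomb b v) = v) -> (forall x, k x = 0 -> k (h x) = 0) ->
  (1 < N)%N -> onto_mod N h ->
  let X := \matrix_i k (h (b i)) in
  (forall y, k (h y) = k y *m X) /\ \det X != 0.
Proof.
move=> kb hk N1 hN X.
have kh y : k (h y) = k y *m X.
  have : k (y - lincomb b (k y)) = 0 by rewrite raddfB /= kb subrr.
  move=> /hk; rewrite !raddfB /= => /subr0_eq ->.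
  rewrite mulmx_sum_row !raddf_sum; apply: eq_bigr => i _.
  by rewrite !raddfMz rowK -[X in X *: _]intz scaler_int.
split=> //.
have /choice[w /choice[z wz]] : forall i, exists w z, b i = h w + z *+ N.
  by move=> i; apply: hN.
apply: (@det_onto_mod _ _ (\matrix_i k (w i)) (- \matrix_i k (z i)) N N1).
apply/row_matrixP => i; rewrite row_mul rowK -kh.
transitivity (k (b i) - k (z i) *+ N).
  by rewrite [in RHS]wz raddfD raddfMn addrK.
apply/rowP => j; rewrite -(lincomb_delta b) kb !(mxE, mulmxnE) eqxx.
by rewrite [j == i]eq_sym mulNrn.
Qed.

Lemma onto_mod_torsion_coords (V : zmodType) N (h : {additive V -> V}) :
  fg_group V -> (1 < N)%N -> onto_mod N h ->
  exists n (k : {additive V -> 'rV[int]_n}) (b : 'I_n -> V) (X : 'M_n),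
    [/\ forall x, torsion x <-> k x = 0, forall v, k (lincomb b v) = v,
        forall y, k (h y) = k y *m X & \det X != 0].
Proof.
move=> fgV N1 hN.
have [|n [k [b [kT _ kb]]]] := free_quotient fgV (subgroup_torsion V).
  move=> x a a0 [c c0]; rewrite -mulrzA => xac; exists (a * c) => //.
  by rewrite mulf_neq0.
have [|kh X0] := onto_mod_matrix kb _ N1 hN.
  move=> x /kT[a a0 xa]; apply/kT; exists a => //.
  by rewrite -raddfMz xa raddf0.
by exists n, k, b, (\matrix_i k (h (b i))).
Qed.

Lemma onto_mod_finite_index (V : zmodType) N (h : {additive V -> V}) :
  fg_group V -> (1 < N)%N -> onto_mod N h ->
  exists2 d : int, d != 0 & forall y, exists w, torsion (y *~ d - h w).
Proof.
move=> fgV N1 hN.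
have [n [k [b [X [kT kb kh X0]]]]] := onto_mod_torsion_coords fgV N1 hN.
exists (\det X) => // y; exists (lincomb b (k y *m \adj X)); apply/kT.
rewrite raddfB /= kh kb -mulmxA mul_adj_mx mul_mx_scalar raddfMz.
by rewrite -scaler_int intz subrr.
Qed.

Lemma onto_mod_ker (V : zmodType) N (h : {additive V -> V}) :
  fg_group V -> (1 < N)%N -> onto_mod N h -> forall x, h x = 0 -> torsion x.
Proof.
move=> fgV N1 hN x hx.
have [n [k [b [X [kT _ kh X0]]]]] := onto_mod_torsion_coords fgV N1 hN.
by apply/kT/(mulmx_det_eq0 X0); rewrite -kh hx raddf0.
Qed.

(** Over the rationals, injectivity makes the rank of [W] equal to the number of
    rows, and the left inverse modulo [N] makes it equal to the number of
    columns. *)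
Lemma square_of_injective_onto_mod k l (W : 'M[int]_(k, l)) N
    (X : 'M_(l, k)) Z : (1 < N)%N -> (forall v : 'rV_k, v *m W = 0 -> v = 0) ->
  X *m W = 1%:M + Z *+ N -> k = l.
Proof.
move=> N1 Winj XW; pose q := map_mx (intr : int -> rat).
apply/eqP; rewrite eqn_leq; apply/andP; split.
  suff /eqP <- : row_free (q k l W) by apply: rank_leq_col.
  apply: inj_row_free => v vW; have [a a0 [u uE]] : exists2 a : int, a != 0 &
      exists u : 'rV_k, q 1%N k u = a%:~R *: v.
    exists (\prod_j denq (v 0 j)).
      by apply/prodf_neq0 => j _; rewrite denq_neq0.
    exists (\row_j (numq (v 0 j) * \prod_(i | i != j) denq (v 0 i))).
    apply/rowP => j; rewrite /q !mxE [\prod_i _](bigD1 j) // !intrM.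
    rewrite -[X in _ = _ * X]divq_num_den.
    by rewrite [RHS]mulrC mulrA divfK // intr_eq0 denq_neq0.
  have u0 : u = 0.
    apply/Winj/(@map_intr_inj rat); rewrite /q in uE vW.
    by rewrite map_mxM map_mx0 uE -scalemxAl vW scaler0.
  move: uE; rewrite u0 /q map_mx0 => /esym/eqP.
  by rewrite scaler_eq0 intr_eq0 (negbTE a0) => /eqP.
have d0 : \det (X *m W) != 0.
  by apply: (@det_onto_mod _ _ 1%:M Z N); rewrite // mul1mx.
rewrite -(@mxrank_unit _ l (q l l (X *m W))); last first.
  by rewrite unitmxE det_map_mx unitfE intr_eq0.
by rewrite /q map_mxM (leq_trans (mxrankM_maxr _ _)) ?rank_leq_row.
Qed.

(** * Products in nonassociative rings *)

Section NARingTheory.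
Variable R : naRingType.

Definition lmul (x y : R) : R := (x * y)%g.
Definition rmul (x y : R) : R := (y * x)%g.

Fact lmul_is_zmod_morphism x : zmod_morphism (lmul x).
Proof.
have h : {morph lmul x : y z / y + z} by move=> y z; rewrite /lmul namulDr.
move=> y z; apply/eqP; rewrite eq_sym subr_eq -h subrK; exact/eqP.
Qed.

Fact rmul_is_zmod_morphism x : zmod_morphism (rmul x).
Proof.
have h : {morph rmul x : y z / y + z} by move=> y z; rewrite /rmul namulDl.
move=> y z; apply/eqP; rewrite eq_sym subr_eq -h subrK; exact/eqP.
Qed.

HB.instance Definition _ x :=
  GRing.isZmodMorphism.Build R R (lmul x) (lmul_is_zmod_morphism x).
HB.instance Definition _ x :=
  GRing.isZmodMorphism.Build R R (rmul x) (rmul_is_zmod_morphism x).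

Lemma namulBl (x y z : R) : ((x - y) * z)%g = (x * z)%g - (y * z)%g.
Proof. exact: (raddfB (rmul z)). Qed.
Lemma namulBr (x y z : R) : (z * (x - y))%g = (z * x)%g - (z * y)%g.
Proof. exact: (raddfB (lmul z)). Qed.
Lemma namul0r (z : R) : (0 * z)%g = 0. Proof. exact: (raddf0 (rmul z)). Qed.
Lemma namulr0 (z : R) : (z * 0)%g = 0. Proof. exact: (raddf0 (lmul z)). Qed.
Lemma namulMzl (x z : R) a : ((x *~ a) * z)%g = (x * z)%g *~ a.
Proof. exact: (raddfMz (rmul z)). Qed.
Lemma namulMzr (x z : R) a : (z * (x *~ a))%g = (z * x)%g *~ a.
Proof. exact: (raddfMz (lmul z)). Qed.
Lemma namulMnl (x z : R) n : ((x *+ n) * z)%g = (x * z)%g *+ n.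
Proof. exact: (raddfMn (rmul z)). Qed.
Lemma namulMnr (x z : R) n : (z * (x *+ n))%g = (z * x)%g *+ n.
Proof. exact: (raddfMn (lmul z)). Qed.
Lemma namul_lincombl m (g : 'I_m -> R) c z :
  (lincomb g c * z)%g = lincomb (fun i => (g i * z)%g) c.
Proof. exact: (raddf_lincomb (rmul z)). Qed.
Lemma namul_lincombr m (g : 'I_m -> R) c z :
  (z * lincomb g c)%g = lincomb (fun i => (z * g i)%g) c.
Proof. exact: (raddf_lincomb (lmul z)). Qed.
End NARingTheory.

(** * Uniformly definable relations *)

(** A relation on [V]-indexed tuples that one formula defines in all rings. The
    formula may depend on the choice of the variables that hold the tuple; as
    this choice is arbitrary, reindexing a tuple needs no substitution in
    formulas. *)
Definition fo_rel (V : finType) (Q : forall R : naRingType, (V -> R) -> Prop) :=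
  forall h : V -> nat, exists f, forall (R : naRingType) (e : nat -> R),
    holds e f <-> Q R (fun v => e (h v)).

(** The language has no symbol for opposites, so a term function is a difference
    of two terms. *)
Definition fo_term (V : finType) (t : forall R : naRingType, (V -> R) -> R) :=
  forall h : V -> nat, exists p q, forall (R : naRingType) (e : nat -> R),
    t R (fun v => e (h v)) = eval e p - eval e q.

Section Terms.
Variable V : finType.
Implicit Types t u : forall R : naRingType, (V -> R) -> R.

Lemma fo_var v : fo_term (fun R (e : V -> R) => e v).
Proof. by move=> h; exists (Var (h v)), Zero => R e /=; rewrite subr0. Qed.

Lemma fo_zero : fo_term (fun R (e : V -> R) => 0 : R).
Proof. by move=> h; exists Zero, Zero => R e /=; rewrite subr0. Qed.

Lemma fo_add t u : fo_term t -> fo_term u -> fo_term (fun R e => t R e + u R e).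
Proof.
move=> ft fu h; have [p [q pq]] := ft h; have [r [s rs]] := fu h.
by exists (Add p r), (Add q s) => R e /=; rewrite pq rs opprD addrACA.
Qed.

Lemma fo_opp t : fo_term t -> fo_term (fun R e => - t R e).
Proof.
by move=> ft h; have [p [q pq]] := ft h; exists q, p => R e; rewrite pq opprB.
Qed.

Lemma fo_mul t u : fo_term t -> fo_term u ->
  fo_term (fun R e => (t R e * u R e)%g).
Proof.
move=> ft fu h; have [p [q pq]] := ft h; have [r [s rs]] := fu h.
exists (Add (Mul p r) (Mul q s)), (Add (Mul p s) (Mul q r)) => R e /=.
by rewrite pq rs namulBl !namulBr opprB addrACA opprD.
Qed.

Lemma fo_muln t n : fo_term t -> fo_term (fun R e => t R e *+ n).
Proof.
move=> ft; elim: n => [|n IH]; first exact: fo_zero.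
move=> h; have [p [q pq]] := fo_add ft IH h.
by exists p, q => R e; rewrite -pq mulrS.
Qed.

Lemma fo_mulz t a : fo_term t -> fo_term (fun R e => t R e *~ a).
Proof. by case: a => n ft; [|apply: fo_opp]; apply: fo_muln. Qed.

Lemma fo_sum (I : finType) (t : I -> forall R : naRingType, (V -> R) -> R) :
  (forall i, fo_term (t i)) -> fo_term (fun R e => \sum_i t i R e).
Proof.
move=> ft; elim: (index_enum I) => [|i s IH] h.
  have [p [q pq]] := fo_zero h; exists p, q => R e.
  by rewrite -pq big_nil.
have [p [q pq]] := fo_add (ft i) IH h.
by exists p, q => R e; rewrite -pq big_cons.
Qed.

Lemma fo_lincomb m (t : 'I_m -> forall R : naRingType, (V -> R) -> R) c :
  (forall i, fo_term (t i)) ->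
  fo_term (fun R e => lincomb (fun i => t i R e) c).
Proof. by move=> ft; apply: fo_sum => i; apply: fo_mulz. Qed.

End Terms.

Lemma holds_block (R : naRingType) (e : nat -> R) s f :
  holds e (foldr Exists f s) <->
  exists2 e', forall i, i \notin s -> e' i = e i & holds e' f.
Proof.
elim: s e => [|i s IH] e /=.
  split=> [|[e' ee' fe']]; first by exists e.
  by rewrite (_ : e = e') //; apply/funext => i; rewrite ee'.
split=> [[x /IH[e' ee' fe']]|[e' ee' fe']].
  exists e' => // j; rewrite inE negb_or => /andP[/negbTE ji /ee' ->].
  by rewrite /= ji.
exists (e' i); apply/IH; exists e' => // j js /=.
by case: eqP => [->//|/eqP ji]; rewrite ee' // inE negb_or ji.
Qed.

Section Formulas.
Variable V : finType.
Implicit Types P Q : forall R : naRingType, (V -> R) -> Prop.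

Lemma fo_eq (t u : forall R : naRingType, (V -> R) -> R) :
  fo_term t -> fo_term u -> fo_rel (fun R e => t R e = u R e).
Proof.
move=> ft fu h; have [p [q pq]] := ft h; have [r [s rs]] := fu h.
exists (Eq (Add p s) (Add r q)) => R e /=; rewrite pq rs.
have E (a b c d : R) : (a - b == c - d) = (a + d == c + b).
  by rewrite subr_eq addrAC eq_sym subr_eq eq_sym.
by split=> /eqP H; apply/eqP; rewrite ?E // -E.
Qed.

Lemma fo_const (C : Prop) : fo_rel (fun R (e : V -> R) => C).
Proof.
have [c|nc] := pselect C; last by move=> h; exists Bot => R e; split.
by move=> h; exists (Not Bot) => R e; split => // _ [].
Qed.

Lemma fo_not P : fo_rel P -> fo_rel (fun R e => ~ P R e).
Proof.
move=> fP h; have [p pP] := fP h; exists (Not p) => R e /=.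
by split=> nP /pP.
Qed.

Lemma fo_and P Q : fo_rel P -> fo_rel Q -> fo_rel (fun R e => P R e /\ Q R e).
Proof.
move=> fP fQ h; have [p pP] := fP h; have [q qQ] := fQ h.
by exists (And p q) => R e /=; rewrite pP qQ.
Qed.

Lemma fo_imp P Q : fo_rel P -> fo_rel Q -> fo_rel (fun R e => P R e -> Q R e).
Proof.
move=> fP fQ h; have [p pP] := fP h; have [q qQ] := fQ h.
by exists (Imp p q) => R e /=; rewrite pP qQ.
Qed.

Lemma fo_iff P Q : (forall R e, P R e <-> Q R e) -> fo_rel P -> fo_rel Q.
Proof.
by move=> PQ fP h; have [p pP] := fP h; exists p => R e; rewrite pP.
Qed.

Lemma fo_forall_fin (I : finType)
    (P : I -> forall R : naRingType, (V -> R) -> Prop) :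
  (forall i, fo_rel (P i)) -> fo_rel (fun R e => forall i, P i R e).
Proof.
move=> fP; apply: (@fo_iff (fun R e => forall i, i \in enum I -> P i R e)).
  by move=> R e; split=> allP i *; apply: allP; rewrite ?mem_enum.
elim: (enum I) => [|i s IH].
  by apply: (@fo_iff (fun _ _ => True)); [|apply: fo_const].
apply: (fo_iff _ (fo_and (fP i) IH)) => R e; split=> [[Pi Ps] j|Ps].
  by rewrite inE => /predU1P[->|/Ps].
by split=> [|j js]; apply: Ps; rewrite inE ?eqxx ?js ?orbT.
Qed.

Lemma fo_exists_fin (I : finType)
    (P : I -> forall R : naRingType, (V -> R) -> Prop) :
  (forall i, fo_rel (P i)) -> fo_rel (fun R e => exists i, P i R e).
Proof.
move=> fP; apply: (@fo_iff (fun R e => ~ forall i, ~ P i R e)).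
  move=> R e; split=> [H|[i Pi] /(_ i)//].
  by apply: contrapT => /forallNP.
by apply: fo_not; apply: fo_forall_fin => i; apply: fo_not.
Qed.

End Formulas.

(** The bound variables of the block of quantifiers are taken beyond all
    variables that the outer tuple uses, which is what rules out capture. *)
Lemma fo_exists (V W : finType)
    (Q : forall R : naRingType, (V -> R) -> (W -> R) -> Prop) :
  fo_rel (fun R (e : V + W -> R) =>
    Q R (fun v => e (inl v)) (fun w => e (inr w))) ->
  fo_rel (fun R (x : V -> R) => exists y : W -> R, Q R x y).
Proof.
move=> fQ h; pose K := (\max_v h v).+1.
have hK v : (h v < K)%N by rewrite ltnS; apply: leq_bigmax.
pose h' (u : V + W) :=
  match u with inl v => h v | inr w => (K + enum_rank w)%N end.
have [f fQf] := fQ h'; exists (foldr Exists f (iota K #|W|)) => R e.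
rewrite holds_block; split=> [[e' ee' /fQf]|[y Qxy]].
  rewrite /= => Qe; exists (fun w => e' (K + enum_rank w)%N).
  rewrite (_ : (fun v => e (h v)) = (fun v => e' (h v))) //; apply/funext => v.
  by rewrite ee' // mem_iota negb_and -ltnNge hK.
pose e' i := if (i < K)%N then e i else
  if insub (i - K)%N is Some j then y (@enum_val W W j) else e i.
exists e'; last first.
  apply/fQf => /=.
  rewrite (_ : (fun v => e' (h v)) = (fun v => e (h v))); last first.
    by apply/funext => v; rewrite /e' hK.
  rewrite (_ : (fun w => _) = y) //; apply/funext => w.
  rewrite /e' ltnNge leq_addr /= addKn insubT //= => lt.
  by rewrite (_ : Sub _ _ = enum_rank w) ?enum_rankK //; apply: val_inj.
move=> i; rewrite mem_iota negb_and -ltnNge /e'; case: ltnP => //= Ki.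
rewrite -leqNgt => KWi; rewrite insubF //; apply/negbTE.
by rewrite -leqNgt leq_subRL.
Qed.

Lemma fo_forall (V W : finType)
    (Q : forall R : naRingType, (V -> R) -> (W -> R) -> Prop) :
  fo_rel (fun R (e : V + W -> R) =>
    Q R (fun v => e (inl v)) (fun w => e (inr w))) ->
  fo_rel (fun R (x : V -> R) => forall y : W -> R, Q R x y).
Proof.
move=> fQ; apply: (@fo_iff _ (fun R x => ~ exists y : W -> R, ~ Q R x y)).
  move=> R x; split=> [H y|allQ [y]]; last by apply.
  by apply: contrapT => nQ; apply: H; exists y.
by apply: fo_not; apply: fo_exists; apply: fo_not.
Qed.

Lemma fo_exists1 (V : finType)
    (Q : forall R : naRingType, (V -> R) -> R -> Prop) :
  fo_rel (fun R (e : V + unit -> R) => Q R (fun v => e (inl v)) (e (inr tt))) ->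
  fo_rel (fun R (x : V -> R) => exists y : R, Q R x y).
Proof.
move=> fQ; apply: (@fo_iff _ (fun R x => exists y : unit -> R, Q R x (y tt))).
  by move=> R x; split=> [[y]|[y]] Qy; [exists (y tt)|exists (fun=> y)].
exact: fo_exists.
Qed.

Lemma fo_forall1 (V : finType)
    (Q : forall R : naRingType, (V -> R) -> R -> Prop) :
  fo_rel (fun R (e : V + unit -> R) => Q R (fun v => e (inl v)) (e (inr tt))) ->
  fo_rel (fun R (x : V -> R) => forall y : R, Q R x y).
Proof.
move=> fQ; apply: (@fo_iff _ (fun R x => forall y : unit -> R, Q R x (y tt))).
  by move=> R x; split=> [Qy y|Qy y]; [apply: (Qy (fun=> y))|apply: Qy].
exact: fo_forall.
Qed.

Lemma fo_exists2 (V I J : finType)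
    (Q : forall R : naRingType, (V -> R) -> (I -> J -> R) -> Prop) :
  fo_rel (fun R (e : V + I * J -> R) =>
        Q R (fun v => e (inl v)) (fun i j => e (inr (i, j)))) ->
  fo_rel (fun R (x : V -> R) => exists y : I -> J -> R, Q R x y).
Proof.
move=> fQ; apply: (@fo_iff _
  (fun R x => exists y : I * J -> R, Q R x (fun i j => y (i, j)))).
  move=> R x; split=> [[y]|[y]] Qy; first by exists (fun i j => y (i, j)).
  by exists (fun ij => y ij.1 ij.2).
exact: fo_exists.
Qed.

(** * Transferring a tuple along an elementary equivalence *)

Lemma fv_foldr_Exists s f :
  formula_fv (foldr Exists f s) = [seq i <- formula_fv f | i \notin s].
Proof.
elim: s => [|i s IH] /=; first by rewrite filter_predT.
rewrite IH -filter_predI; apply: eq_filter => j /=.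
by rewrite inE negb_or.
Qed.

Lemma elem_equiv_fo (R S : naRingType) (V : finType)
    (Q : forall R : naRingType, (V -> R) -> Prop) (x : V -> R) :
  elem_equiv R S -> fo_rel Q -> Q R x -> exists y : V -> S, Q S y.
Proof.
move=> RS fQ Qx; have [f fQf] := fQ (fun v => enum_rank v : nat).
(* Quantifying the variables of the tuple as well, free or not, leaves all the
   other variables with value 0. *)
pose g := foldr Exists f (formula_fv f ++ iota 0 #|V|).
have gQ (T : naRingType) : models T g <-> exists y : V -> T, Q T y.
  rewrite /models holds_block; split=> [[e _ /fQf Qe]|[y Qy]].
    by exists (fun v => e (enum_rank v)).
  pose e i := if insub i is Some j then y (@enum_val V V j) else 0.
  exists e => [i|].
    rewrite mem_cat mem_iota negb_or /= add0n => /andP[_ /negbTE iV].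
    by rewrite /e insubF.
  apply/fQf; rewrite (_ : (fun v => _) = y) //; apply/funext => v.
  rewrite /e insubT //= => lt.
  by rewrite (_ : Sub _ _ = enum_rank v) ?enum_rankK //; apply: val_inj.
have sg : sentence g.
  rewrite /sentence fv_foldr_Exists -(filter_pred0 (formula_fv f)).
  by apply: eq_in_filter => i fi; rewrite mem_cat fi.
by apply/gQ/RS/gQ => //; exists x.
Qed.

Lemma fg_rV n : fg_group 'rV[int]_n.
Proof.
exists n, (fun i => delta_mx 0 i); split=> // c _; exists c.
rewrite {1}(row_sum_delta c); apply: eq_bigr => i _.
by rewrite -[X in X *: _]intz scaler_int.
Qed.

(** One existential sentence asserts all that is needed of the images of [x] and
    of a generating family [g] of [R]: the relation [Q], the expression of [x]
    in terms of [g], the finitely many linear relations and products of [g], the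
    finitely many classes modulo [N], and that the finitely many nonzero torsion
    elements stay nonzero. *)
Lemma elem_equiv_transfer (R S : naRingType) (V : finType)
    (Q : forall R : naRingType, (V -> R) -> Prop) (x : V -> R) N :
  fg_group R -> elem_equiv R S -> fo_rel Q -> Q R x -> (0 < N)%N ->
  exists phi : {additive R -> S},
    [/\ {morph phi : y z / (y * z)%g}, Q S (phi \o x), onto_mod N phi
      & forall y, torsion y -> phi y = 0 -> y = 0].
Proof.
move=> fgR RS fQ Qx N0.
have [m [g [_ gR]]] := fgR.
have /choice[co coE] : forall y, exists c, y = lincomb g c.
  by move=> y; apply: gR.
have [q [B [B0 BR]]] : fin_gen (fun c : 'rV_m => lincomb g c = 0).
  apply: fin_gen_subgroup (@fg_rV m) _ => //; split; first by rewrite raddf0.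
  by move=> c d /= gc gd; rewrite raddfB /= gc gd subr0.
have [w [h [_ hR]]] := finite_mod (conj I (fun _ _ _ _ => I)) fgR N0.
have fgT := fin_gen_torsion fgR.
have [b b0 bT] := torsion_exponent (subgroup0 R) fgT (fun x => id).
have [u [t [tT tR]]] := finite_mod (subgroup_torsion R) fgT b0.
pose Q' (T : naRingType) (e : V + 'I_m -> T) :=
  Q T (fun v => e (inl v)) /\
  (forall v, e (inl v) = lincomb (fun i => e (inr i)) (co (x v))) /\
  (forall r, lincomb (fun i => e (inr i)) (B r) = 0) /\
  (forall ij : 'I_m * 'I_m, (e (inr ij.1) * e (inr ij.2))%g =
     lincomb (fun i => e (inr i)) (co (g ij.1 * g ij.2)%g)) /\
  (forall y, exists z, exists i,
     y = lincomb (fun i => e (inr i)) (co (h i)) + z *+ N) /\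
  (forall i, t i <> 0 -> ~ lincomb (fun i => e (inr i)) (co (t i)) = 0).
have fQ' : fo_rel Q'.
  have fL (W : finType) (k : 'I_m -> W) c :
      fo_term (fun T (e : W -> T) => lincomb (fun i => e (k i)) c).
    by apply: fo_lincomb => i; apply: fo_var.
  do ![apply: fo_and].
  - by move=> k; have [f fP] := fQ (k \o inl); exists f.
  - by apply: fo_forall_fin => v; apply: fo_eq => //; apply: fo_var.
  - by apply: fo_forall_fin => r; apply: fo_eq => //; apply: fo_zero.
  - apply: fo_forall_fin => ij; apply: fo_eq => //.
    by apply: fo_mul; apply: fo_var.
  - apply: fo_forall1; apply: fo_exists1; apply: fo_exists_fin => i.
    apply: fo_eq; first exact: fo_var.
    apply: fo_add; first exact: (fL _ (fun i => inl (inl (inr i)))).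
    by apply: fo_muln; apply: fo_var.
  - apply: fo_forall_fin => i; apply: fo_imp; first exact: fo_const.
    by apply: fo_not; apply: fo_eq => //; apply: fo_zero.
pose e0 (v : V + 'I_m) := match v with inl v => x v | inr i => g i end.
have [|e [Qe [ex [eB [eM [eN eT]]]]]] := @elem_equiv_fo R S _ Q' e0 RS fQ'.
  split=> //; split=> [v|]; first exact: coE.
  split=> [r|]; first exact: B0.
  split=> [ij|]; first exact: coE.
  split=> [y|i ti]; last by rewrite -coE.
  have [//|i [z [_ ->]]] := hR y; exists z, i; congr (_ + _); exact: coE.
pose g' i := e (inr i).
have rel c : lincomb g c = 0 -> lincomb g' c = 0.
  move=> /BR[d ->]; rewrite raddf_lincomb; apply: big1 => r _.
  by rewrite /= (eB r : lincomb g' (B r) = 0) mul0rz.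
have coP y c : y = lincomb g c -> lincomb g' (co y) = lincomb g' c.
  move=> yE; apply/eqP; rewrite -subr_eq0 -raddfB; apply/eqP/rel.
  by rewrite raddfB /= -coE -yE subrr.
have phi_add : zmod_morphism (fun y => lincomb g' (co y)).
  move=> y z; rewrite -raddfB; apply: coP.
  by rewrite raddfB /= -!coE.
have [phi phiE] : exists phi : {additive R -> S},
    forall y, phi y = lincomb g' (co y).
  by exists (HB.pack_for {additive R -> S} (fun y => lincomb g' (co y))
               (GRing.isZmodMorphism.Build R S _ phi_add)).
have phig i : phi (g i) = g' i.
  by rewrite phiE -[RHS]lincomb_delta; apply: coP; rewrite lincomb_delta.
exists phi; split=> [y z||y|y].
- rewrite {1}(coE y) namul_lincombl raddf_lincomb (phiE y) namul_lincombl.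
  apply: eq_lincomb => i /=.
  rewrite {1}(coE z) namul_lincombr raddf_lincomb (phiE z) namul_lincombr.
  by apply: eq_lincomb => j /=; rewrite phiE (eM (i, j)).
- rewrite (_ : phi \o x = (fun v => e (inl v))) //; apply/funext => v.
  by rewrite ex /= phiE.
- by have [z [i ->]] := eN y; exists (h i), z; rewrite phiE.
move=> /tR[i [z [/bT zb ->]]]; rewrite zb addr0 => ti.
by move: ti; rewrite phiE; apply: contraPP => /eT.
Qed.

(** * Commutative rings of integer matrices *)

Lemma char_poly_intertwine (R : idomainType) n (A B X : 'M[R]_n) :
  A *m X = X *m B -> \det X != 0 -> char_poly A = char_poly B.
Proof.
move=> AX X0; apply: (@mulfI _ (\det X)%:P); first by rewrite polyC_eq0.
rewrite /char_poly mulrC -det_map_mx -!det_mulmx; congr determinant.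
by rewrite mulmxBl mulmxBr -!map_mxM AX scalar_mxC.
Qed.

Lemma char_poly_nilpotent (R : comNzRingType) n (A : 'M[R]_n) :
  char_poly A = 'X^n -> A ^+ n = 0.
Proof.
case: n A => [|n] A cA; first exact: flatmx0.
by have := Cayley_Hamilton A; rewrite cA rmorphXn /= horner_mx_X.
Qed.

Lemma intertwine_exp (R : pzRingType) n (A B X : 'M[R]_n) k :
  A * X = X * B -> A ^+ k * X = X * B ^+ k.
Proof.
move=> AX; elim: k => [|k IH]; first by rewrite !expr0 mul1r mulr1.
by rewrite !exprS -mulrA IH mulrA AX mulrA.
Qed.

Lemma fg_mx m n : fg_group 'M[int]_(m, n).
Proof.
have [k [g [_ gV]]] := @fg_rV (m * n).
exists k, (vec_mx \o g); split=> // A _; have [//|c cE] := gV (mxvec A).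
by exists c; rewrite -[LHS]mxvecK cE raddf_lincomb.
Qed.

Section CommutativeOrder.
Variables (n : nat) (P : 'M[int]_n -> Prop).
Hypotheses (sP : subgroup P) (P1 : P 1).
Hypothesis PM : forall A B, P A -> P B -> P (A * B).
Hypothesis PC : forall A B, P A -> P B -> A * B = B * A.

(** After simultaneous triangularisation over the algebraic numbers, the
    diagonals of matrices with the same characteristic polynomial take only
    finitely many values; two matrices with the same diagonal differ by a
    nilpotent matrix. *)
Lemma nilpotent_difference (a : nat -> 'M[int]_n) :
  (forall k, P (a k)) -> (forall k, char_poly (a k) = char_poly (a 0%N)) ->
  exists i j, (i < j)%N /\ (a i - a j) ^+ n = 0.
Proof.
move=> Pa ca.
have [m [g [Pg gP]]] : fin_gen P by apply: fin_gen_subgroup sP (@fg_mx n n) _.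
pose C : 'M[int]_n -> 'M[algC]_n := map_mx intr.
have [|U Uu /allP trigU] :=
  @cotrigonalization _ n [seq C (g i) | i <- enum 'I_m].
  move=> _ _ /mapP[i _ ->] /mapP[j _ ->].
  by rewrite /comm_mx /C -!map_mxM; congr map_mx; apply: PC.
have {Uu} Uu := unitarymx_unit Uu.
pose T A := U *m C A *m invmx U.
have TB A B i j : T (A - B) i j = T A i j - T B i j.
  rewrite [T (A - B)](_ : _ = T A - T B); last first.
    by rewrite /T /C map_mxB mulmxBr mulmxBl.
  by move: (T A) (T B) => TA TB; rewrite !mxE.
have trigT A : P A -> is_trig_mx (T A).
  move=> /gP[c ->]; apply: (@subgroup_lincomb _ (fun A => is_trig_mx (T A))).
    split; first by rewrite /T /C map_mx0 mulmx0 mul0mx mx0_is_trig.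
    move=> X Y /is_trig_mxP tX /is_trig_mxP tY; apply/is_trig_mxP => i j ij.
    by rewrite TB tX // tY // subr0.
  move=> i; have /trigU /= : C (g i) \in [seq C (g i) | i <- enum 'I_m].
    by apply/mapP; exists i; rewrite ?mem_enum.
  by rewrite /similar_to /= conjumx.
have charT A : char_poly (T A) = map_poly intr (char_poly A).
  rewrite map_char_poly; apply: (char_poly_intertwine (X := U)).
    by rewrite /T mulmxKV.
  by rewrite -unitfE -unitmxE.
have prodT A : P A ->
    map_poly intr (char_poly A) = \prod_(i < n) ('X - (T A i i)%:P).
  by move=> PA; rewrite -charT char_poly_trig // trigT.
have diagT k : exists f : {ffun 'I_n -> 'I_n},
    forall i, T (a k) i i = T (a 0%N) (f i) (f i).
  have /choice[f fE] : forall i, exists j, T (a k) i i = T (a 0%N) j j.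
    move=> i; have : root (map_poly intr (char_poly (a 0%N))) (T (a k) i i).
      rewrite -(ca k) prodT // /root horner_prod.
      apply/prodf_eq0; exists i => //.
      by rewrite hornerXsubC subrr.
    rewrite prodT // /root horner_prod => /prodf_eq0[j _].
    by rewrite hornerXsubC subr_eq0 => /eqP; exists j.
  by exists [ffun i => f i] => i; rewrite ffunE.
have [f fE] := choice diagT.
pose M := #|{ffun 'I_n -> 'I_n}|.
have /injectivePn[x [y]] : ~~ injectiveb (fun k : 'I_M.+1 => f k).
  apply/injectiveP => /leq_card; rewrite card_ord.
  by rewrite -/M ltnn.
have nil i j : f i = f j -> (a i - a j) ^+ n = 0.
  move=> fij; apply: char_poly_nilpotent.
  apply: (@map_inj_poly _ algC intr); [exact: intr_inj|by []|].
  rewrite prodT ?map_polyXn; last exact: sP.2.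
  rewrite (eq_bigr (fun=> 'X)) ?prodr_const ?card_ord // => k _.
  by rewrite TB (fE i) (fE j) fij subrr subr0.
case: (ltngtP x y) => [xy|xy|/val_inj->]; last by rewrite eqxx.
  by move=> _ fxy; exists x, y; split => //; apply: nil.
by move=> _ fxy; exists y, x; split => //; apply: nil.
Qed.

(** Recursion on the list isolates one generator, which is the form in which
    generators are eliminated below. *)
Fixpoint ideal_span (s : seq 'M[int]_n) (A : 'M[int]_n) : Prop :=
  if s is j :: s' then exists2 B, P B & ideal_span s' (A - j * B) else A = 0.

Lemma subgroup_ideal_span s : subgroup (ideal_span s).
Proof.
elim: s => [|j s IH] /=; first exact: subgroup0.
split; first by exists 0; rewrite ?mulr0 ?subr0; [apply: sP.1|apply: IH.1].
move=> A B [A' PA' IA] [B' PB' IB]; exists (A' - B'); first exact: sP.2.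
have := IH.2 _ _ IA IB; congr ideal_span.
by rewrite mulrBr !opprD !opprK addrACA.
Qed.

Lemma ideal_spanM s A B : (forall j, j \in s -> P j) -> P A ->
  ideal_span s B -> ideal_span s (A * B).
Proof.
elim: s B => [|j s IH] B /= Ps PA; first by move=> ->; rewrite mulr0.
move=> [C PC' IC]; exists (A * C); first exact: PM.
have Pj : P j by apply: Ps; rewrite inE eqxx.
rewrite mulrA -(PC PA Pj) -mulrA -mulrBr; apply: IH => // k ks.
by apply: Ps; rewrite inE ks orbT.
Qed.

Lemma ideal_span_sum (I : Type) (j g : I -> 'M[int]_n) s :
  (forall i, P (g i)) -> ideal_span (map j s) (\sum_(i <- s) j i * g i).
Proof.
move=> Pg; elim: s => [|i s IH] /=; first by rewrite big_nil.
by exists (g i) => //; rewrite big_cons addrAC subrr add0r.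
Qed.

(** A nilpotent generator [j] that lies in the subring can be dropped: use the
    hypothesis for the coefficient of [j], then for the coefficient of its
    square, and so on. *)
Lemma subring_mod_nilpotents (Q : 'M[int]_n -> Prop) s :
  subgroup Q -> Q 1 -> (forall A B, Q A -> Q B -> Q (A * B)) ->
  (forall A, Q A -> P A) ->
  (forall j, j \in s -> Q j /\ exists k, j ^+ k = 0) ->
  (forall A, P A -> exists2 B, Q B & ideal_span s (A - B)) ->
  forall A, P A -> Q A.
Proof.
move=> sQ Q1 QM QP; elim: s => [|j s IH] Qs gen A PA.
  by have [B QB /subr0_eq ->] := gen A PA.
have Qs' k : k \in s -> Q k /\ exists m, k ^+ m = 0.
  by move=> ks; apply: Qs; rewrite inE ks orbT.
have Ps' k : k \in s -> P k by case/Qs' => /QP.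
have [Qj [m jm]] := Qs j (mem_head _ _).
have Qjk k : Q (j ^+ k) by elim: k => [|k]; rewrite ?expr0 ?exprS //; apply: QM.
apply: IH => // {}A {}PA.
suff /(_ m)[B QB [C PC']] : forall k, exists2 B, Q B &
    exists2 C, P C & ideal_span s (A - B - j ^+ k * C).
  by rewrite jm mul0r subr0; exists B.
elim=> [|k [B QB [C PC' IC]]].
  exists 0; first exact: sQ.1.
  exists A; rewrite // expr0 mul1r subr0 subrr.
  exact: (subgroup_ideal_span s).1.
have [D QD [E PE ID]] := gen C PC'.
exists (B + j ^+ k * D); first by apply: (subgroupD sQ) => //; apply: QM.
exists E => //.
have /(subgroupD (subgroup_ideal_span s) IC) :=
  ideal_spanM Ps' (QP _ (Qjk k)) ID.
congr ideal_span; rewrite exprSr !mulrBr mulrA opprD 2![in LHS]addrA subrK.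
by rewrite addrA.
Qed.

(** Conjugation by [X] is an injective endomorphism of [P]. By
    [nilpotent_difference] two elements of the orbit of [A] differ by a
    nilpotent matrix, and undoing the conjugations shows that [A] itself differs
    by a nilpotent matrix from a later element of its orbit, so from a value of
    the endomorphism. The nilpotent matrices are combinations of the [j' l],
    which are nilpotent values of the endomorphism, and are therefore eliminated
    by [subring_mod_nilpotents]. *)
Lemma conjugation_onto (X : 'M[int]_n) q (j j' : 'I_q -> 'M[int]_n) :
  \det X != 0 ->
  (forall A, P A -> exists2 B, P B & A * X = X * B) ->
  (forall l, P (j l)) -> (forall l, exists k, j l ^+ k = 0) ->
  (forall l, P (j' l)) -> (forall l, j l * X = X * j' l) ->
  (forall A k, P A -> A ^+ k = 0 -> exists2 B : 'I_q -> 'M_n,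
     forall l, P (B l) & A = \sum_l j' l * B l) ->
  forall A, P A -> exists2 B, P B & B * X = X * A.
Proof.
move=> X0 XP Pj nj Pj' jX nil.
have X0k k : \det (X ^+ k) != 0.
  elim: k => [|k IH]; first by rewrite expr0 det1 oner_neq0.
  by rewrite exprS det_mulmx mulf_neq0.
pose Q A := P A /\ exists2 B, P B & B * X = X * A.
suff QP A : P A -> Q A by move=> A /QP[].
have nj' l : exists k, j' l ^+ k = 0.
  have [k jk] := nj l; exists k; apply: (mulmx_det_eq0l X0).
  by have := intertwine_exp k (jX l); rewrite jk mul0r => /esym.
apply: (subring_mod_nilpotents (s := map j' (index_enum 'I_q))).
- split.
    by split; [exact: sP.1|exists 0; [exact: sP.1|rewrite mul0r mulr0]].
  move=> {}A B [PA [A' PA' AX]] [PB [B' PB' BX]]; split; first exact: sP.2.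
  by exists (A' - B'); [exact: sP.2|rewrite mulrBl mulrBr AX BX].
- by split=> //; exists 1; rewrite ?mul1r ?mulr1.
- move=> {}A B [PA [A' PA' AX]] [PB [B' PB' BX]]; split; first exact: PM.
  by exists (A' * B'); [exact: PM|rewrite -mulrA BX mulrA AX mulrA].
- by move=> B [].
- by move=> _ /mapP[l _ ->]; split => //; split => //; exists (j l).
move=> {}A PA.
have /choice[s sE] : forall B, exists C, P B -> P C /\ B * X = X * C.
  move=> B; have [/XP[C PC' BX]|nB] := pselect (P B); first by exists C.
  by exists 0.
have Ps B k : P B -> P (iter k s B).
  by move=> PB; elim: k => //= k IH; case: (sE _ IH).
have sX B k : P B -> B * X ^+ k = X ^+ k * iter k s B.
  move=> PB; elim: k => [|k IH]; first by rewrite expr0 mulr1 mul1r.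
  by rewrite exprSr mulrA IH -mulrA (sE _ (Ps _ _ PB)).2 // mulrA.
have [|i [l [il nil_il]]] := nilpotent_difference (Ps A ^~ PA).
  by move=> k; rewrite -(char_poly_intertwine (sX A k PA)).
pose k := (l - i)%N; have k0 : (0 < k)%N by rewrite subn_gt0.
have sXi : (A - iter k s A) * X ^+ i = X ^+ i * (iter i s A - iter l s A).
  rewrite mulrBl mulrBr sX // sX; last exact: Ps.
  by rewrite -iterD subnKC // ltnW.
have Pd : P (A - iter k s A) by apply: sP.2 => //; apply: Ps.
have [|B PB BE] := nil _ n Pd.
  apply: (mulmx_det_eq0 (X0k i)).
  by have := intertwine_exp n sXi; rewrite nil_il mulr0.
exists (iter k s A); last by rewrite BE; apply: ideal_span_sum.
split; first exact: Ps.
exists (iter k.-1 s A); first exact: Ps.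
by rewrite -[k in RHS](prednK k0) /= (sE _ (Ps _ _ PA)).2.
Qed.

End CommutativeOrder.

(** * Scalars of the multiplication *)

Section Codes.
Variables (N n : nat).

(** With [N] a number that kills the torsion, this multiple of the product takes
    torsion-free values, and the quotient by its annihilator [sann] is
    torsion-free. *)
Definition smul (R : naRingType) (x y : R) : R := (x * y)%g *+ N.

Definition sann (R : naRingType) (x : R) :=
  forall y, smul x y = 0 /\ smul y x = 0.

(** Let [x] span a subgroup of finite index modulo [sann]. A tuple [y] encodes
    the endomorphism [A] of the quotient by [sann] that maps each [x i] to [y
    i]. Here the first clause says that [A] is self-adjoint on the span of [x],
    and the second that [A] maps the whole quotient to itself: [v] is the image
    of [u], described by its products with [x]. *)
Definition adj_code (R : naRingType) (x y : 'I_n -> R) : Prop :=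
  (forall ik : 'I_n * 'I_n, smul (y ik.1) (x ik.2) = smul (x ik.1) (y ik.2)) /\
  forall u, exists v, forall k,
    smul v (x k) = smul u (y k) /\ smul (x k) v = smul (y k) u.

(** For self-adjoint endomorphisms, the last equation says that the product of
    the two in one order has the same form as in the other order. *)
Definition scalar_code (R : naRingType) (x y : 'I_n -> R) : Prop :=
  adj_code x y /\ forall z, adj_code x z ->
    forall ik : 'I_n * 'I_n, smul (y ik.1) (z ik.2) = smul (z ik.1) (y ik.2).

(** With [z] equal to [x], this says that the matrix encoded by [y] lies in the
    ideal generated by the matrices that [j] encodes; with [z] equal to [y], it
    says the same of the square of that matrix. *)
Definition nil_code q (R : naRingType) (x : 'I_n -> R) (j : 'I_q -> 'I_n -> R)
    (y z : 'I_n -> R) : Prop :=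
  exists c : 'I_q -> 'I_n -> R, (forall l, scalar_code x (c l)) /\
    forall ik : 'I_n * 'I_n, smul (y ik.1) (z ik.2) =
      \sum_l smul (j l ik.1) (c l ik.2).

(** The three clauses: [p] encodes scalars; [x] spans the ring over the scalars,
    modulo [sann]; the ideal of the scalars generated by [j] is semiprime. *)
Definition scalar_frame r q (R : naRingType) (x : 'I_n -> R)
    (p : 'I_r -> 'I_n -> R) (j : 'I_q -> 'I_n -> R) : Prop :=
  [/\ forall t, scalar_code x (p t),
      forall u, exists c : 'I_n -> 'I_n -> R,
        (forall i, scalar_code x (c i)) /\ sann (u - \sum_i c i i)
    & forall y, scalar_code x y -> nil_code x j y y -> nil_code x j y x].

Section FO.
Variable V : finType.
Implicit Types t u : forall R : naRingType, (V -> R) -> R.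

Lemma fo_smul t u : fo_term t -> fo_term u ->
  fo_term (fun R e => smul (t R e) (u R e)).
Proof. by move=> ft fu; apply: fo_muln; apply: fo_mul. Qed.
End FO.

Lemma fo_adj_code (V : finType) (x y : 'I_n -> V) :
  fo_rel (fun R e => adj_code (fun i => e (x i)) (fun i => e (y i))).
Proof.
apply: fo_and.
  by apply: fo_forall_fin => ik; apply: fo_eq; apply: fo_smul; apply: fo_var.
apply: fo_forall1; apply: fo_exists1; apply: fo_forall_fin => k.
by apply: fo_and; apply: fo_eq; apply: fo_smul; apply: fo_var.
Qed.

Lemma fo_scalar_code (V : finType) (x y : 'I_n -> V) :
  fo_rel (fun R e => scalar_code (fun i => e (x i)) (fun i => e (y i))).
Proof.
apply: fo_and; first exact: fo_adj_code.
apply: fo_forall; apply: fo_imp.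
  exact: (@fo_adj_code _ (fun i => inl (x i)) inr).
by apply: fo_forall_fin => ik; apply: fo_eq; apply: fo_smul; apply: fo_var.
Qed.

Lemma fo_nil_code q (V : finType) (x : 'I_n -> V) (j : 'I_q -> 'I_n -> V)
    (y z : 'I_n -> V) :
  fo_rel (fun R e => nil_code (fun i => e (x i)) (fun l i => e (j l i))
                   (fun i => e (y i)) (fun i => e (z i))).
Proof.
apply: fo_exists2; apply: fo_and.
  apply: fo_forall_fin => l.
  exact: (@fo_scalar_code _ (fun i => inl (x i)) (fun i => inr (l, i))).
apply: fo_forall_fin => ik; apply: fo_eq.
  by apply: fo_smul; apply: fo_var.
by apply: fo_sum => l; apply: fo_smul; apply: fo_var.
Qed.

Lemma fo_scalar_frame r q (V : finType) (x : 'I_n -> V) (p : 'I_r -> 'I_n -> V)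
    (j : 'I_q -> 'I_n -> V) :
  fo_rel (fun R e => scalar_frame (fun i => e (x i)) (fun t i => e (p t i))
                   (fun l i => e (j l i))).
Proof.
pose Q1 (R : naRingType) (e : V -> R) := forall t,
  scalar_code (fun i => e (x i)) (fun i => e (p t i)).
pose Q2 (R : naRingType) (e : V -> R) := forall u, exists c : 'I_n -> 'I_n -> R,
  (forall i, scalar_code (fun i => e (x i)) (c i)) /\
  forall w, smul (u - \sum_i c i i) w = 0 /\ smul w (u - \sum_i c i i) = 0.
pose Q3 (R : naRingType) (e : V -> R) := forall y : 'I_n -> R,
  scalar_code (fun i => e (x i)) y ->
  nil_code (fun i => e (x i)) (fun l i => e (j l i)) y y ->
  nil_code (fun i => e (x i)) (fun l i => e (j l i)) y (fun i => e (x i)).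
apply: (@fo_iff _ (fun R e => Q1 R e /\ (Q2 R e /\ Q3 R e))).
  by move=> R e; split=> [[? []]|[]].
apply: fo_and; first by apply: fo_forall_fin => t; apply: fo_scalar_code.
apply: fo_and.
  apply: fo_forall1; apply: fo_exists2; apply: fo_and.
    apply: fo_forall_fin => i.
    exact: (@fo_scalar_code _ (fun k => inl (inl (x k))) (fun k => inr (i, k))).
  apply: fo_forall1.
  by apply: fo_and; (apply: fo_eq; [apply: fo_smul|apply: fo_zero]);
    do ?[apply: fo_var | apply: fo_add; last apply: fo_opp
        | apply: fo_sum => i].
apply: fo_forall; apply: fo_imp.
  exact: (@fo_scalar_code _ (fun k => inl (x k)) inr).
apply: fo_imp.
  exact: (@fo_nil_code _ _ (fun k => inl (x k)) (fun l k => inl (j l k))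
            inr inr).
exact: (@fo_nil_code _ _ (fun k => inl (x k)) (fun l k => inl (j l k)) inr
          (fun k => inl (x k))).
Qed.

End Codes.

Lemma mulmx_lincomb m n (v : 'rV[int]_m) (A : 'M_(m, n)) :
  v *m A = lincomb (fun i => row i A) v.
Proof.
rewrite mulmx_sum_row; apply: eq_bigr => i _.
by rewrite -[X in X *: _]intz scaler_int.
Qed.

Section Scalars.
Variables (R : naRingType) (N n : nat).
Hypothesis NT : forall x : R, torsion x -> x *+ N = 0.
Hypothesis N0 : (0 < N)%N.
Variables (k : {additive R -> 'rV[int]_n}) (b : 'I_n -> R).
Hypothesis kL : forall x, sann N x <-> k x = 0.
Hypothesis kb : forall v, k (lincomb b v) = v.

Local Notation f := (smul N).
Local Notation s := (lincomb b).

Definition form (v w : 'rV[int]_n) : R := f (s v) (s w).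
Definition forml w v := form v w.

Fact form_is_zmod_morphism v : zmod_morphism (form v).
Proof. by move=> w w'; rewrite /form /smul raddfB namulBr mulrnBl. Qed.
Fact forml_is_zmod_morphism w : zmod_morphism (forml w).
Proof. by move=> v v'; rewrite /forml /form /smul raddfB namulBl mulrnBl. Qed.

HB.instance Definition _ v :=
  GRing.isZmodMorphism.Build 'rV[int]_n R (form v) (form_is_zmod_morphism v).
HB.instance Definition _ w :=
  GRing.isZmodMorphism.Build 'rV[int]_n R (forml w) (forml_is_zmod_morphism w).

Lemma formBl v v' w : form (v - v') w = form v w - form v' w.
Proof. exact: (raddfB (forml w)). Qed.
Lemma form0l w : form 0 w = 0.
Proof. exact: (raddf0 (forml w)). Qed.
Lemma form_suml I r (P : pred I) (v : I -> 'rV_n) w :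
  form (\sum_(i <- r | P i) v i) w = \sum_(i <- r | P i) form (v i) w.
Proof. exact: (raddf_sum (forml w)). Qed.
Lemma form_lincombl m (g : 'I_m -> 'rV_n) c w :
  form (lincomb g c) w = lincomb (fun i => form (g i) w) c.
Proof. exact: (raddf_lincomb (forml w)). Qed.

Lemma smulE x y : f x y = form (k x) (k y).
Proof.
have kx z : sann N (z - s (k z)) by apply/kL; rewrite raddfB /= kb subrr.
transitivity (f (s (k x)) y).
  by apply/eqP; rewrite -subr_eq0 -mulrnBl -namulBl; apply/eqP; case: (kx x y).
apply/eqP; rewrite -subr_eq0 -mulrnBl -namulBr; apply/eqP.
by case: (kx y (s (k x))).
Qed.

Lemma form_nondeg v : (forall w, form v w = 0 /\ form w v = 0) -> v = 0.
Proof. by move=> v0; rewrite -(kb v); apply/kL => y; rewrite !smulE kb. Qed.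

(** The rows of [X] span a subgroup of finite index, and the values of [h] are
    torsion-free. *)
Lemma additive_rows (h : 'rV[int]_n -> R) (X : 'M_n) : zmod_morphism h ->
  (forall u, exists z, h u = z *+ N) -> \det X != 0 ->
  (forall i, h (row i X) = 0) -> forall w, h w = 0.
Proof.
move=> hB hN X0 hX w.
pose H := HB.pack_for {additive 'rV[int]_n -> R} h
            (GRing.isZmodMorphism.Build 'rV[int]_n R h hB).
have hw : h w *~ \det X = 0.
  rewrite -[h]/(H : _ -> _) -raddfMz -scaler_int intz -mul_mx_scalar.
  rewrite -mul_adj_mx mulmxA mulmx_lincomb raddf_lincomb.
  by apply: big1 => i _; rewrite /= hX mul0rz.
have [z zE] := hN w; rewrite zE in hw *; apply: NT; exists (N%:Z * \det X).
  by rewrite mulf_neq0 // (lt0r_neq0 (N0 : 0 < N%:Z)).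
by rewrite mulrzA -pmulrn.
Qed.

Lemma form_rows v (X : 'M_n) : \det X != 0 ->
  (forall i, form v (row i X) = 0) -> forall w, form v w = 0.
Proof.
move=> X0 vX; apply: (additive_rows _ _ X0) => //.
  exact: form_is_zmod_morphism.
by move=> u; exists (s v * s u)%g.
Qed.

Lemma form_rowsl w (X : 'M_n) : \det X != 0 ->
  (forall i, form (row i X) w = 0) -> forall v, form v w = 0.
Proof.
move=> X0 wX; apply: (@additive_rows (forml w) _ _ _ X0) => //.
  exact: forml_is_zmod_morphism.
by move=> u; exists (s u * s w)%g.
Qed.

Definition selfadj (A : 'M[int]_n) :=
  forall v w, form (v *m A) w = form v (w *m A).

(** Products of self-adjoint matrices need not be self-adjoint. Commuting with
    all self-adjoint matrices makes the set closed under products and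
    commutative. *)
Definition scalar_mat (A : 'M[int]_n) :=
  selfadj A /\ forall B, selfadj B -> A * B = B * A.

Lemma subgroup_selfadj : subgroup selfadj.
Proof.
split=> [v w|A B sA sB v w]; first by rewrite !mulmx0 raddf0 form0l.
by rewrite !mulmxBr formBl raddfB /= sA sB.
Qed.

(** Vanishing of the form on one side suffices, because self-adjointness moves
    [A] to the other argument. *)
Lemma selfadj_eq0 A (X : 'M_n) : \det X != 0 -> selfadj A ->
  (forall i l, form (row i X *m A) (row l X) = 0) -> A = 0.
Proof.
move=> X0 sA A0.
have A0' v w : form (v *m A) w = 0.
  rewrite sA; move: v; apply: (form_rowsl X0) => i; rewrite -sA.
  exact: (form_rows X0).
apply/row_matrixP => i; rewrite row0 rowE; apply: form_nondeg => w.
by rewrite A0' -sA A0'.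
Qed.

Lemma selfadj_comm A B (X : 'M_n) : \det X != 0 -> selfadj A -> selfadj B ->
  (forall i l, form (row i X *m A) (row l X *m B) =
               form (row i X *m B) (row l X *m A)) -> A * B = B * A.
Proof.
move=> X0 sA sB ABX.
have AB v w : form (v *m A) (w *m B) = form (v *m B) (w *m A).
  apply/eqP; rewrite -subr_eq0; apply/eqP; move: w.
  apply: (additive_rows _ _ X0) => [w w'|w|l]; last 1 first.
  - move: v; apply: (additive_rows _ _ X0) => [v v'|v|i]; last first.
    + by rewrite ABX subrr.
    + by eexists; rewrite -mulrnBl.
    rewrite !mulmxBl !formBl.
    by rewrite !opprD !opprK addrACA.
  - rewrite !mulmxBl !raddfB /=.
    by rewrite ?opprD !opprK addrACA.
  - by eexists; rewrite -mulrnBl.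
apply/eqP; rewrite -subr_eq0; apply/eqP/row_matrixP => i.
rewrite row0 rowE; apply: form_nondeg => w.
rewrite -!mulmxE mulmxBr !mulmxA raddfB /= formBl (sB _ w) (sA _ w) AB subrr.
by split=> //; rewrite -(sB w) -(sA w) AB subrr.
Qed.

Lemma subgroup_scalar : subgroup scalar_mat.
Proof.
split; first by split=> [|B _]; [exact: subgroup_selfadj.1|rewrite mul0r mulr0].
move=> A B [sA cA] [sB cB]; split; first exact: subgroup_selfadj.2.
by move=> C sC; rewrite mulrBl mulrBr cA // cB.
Qed.

Lemma scalar1 : scalar_mat 1.
Proof. by split=> [v w|B _]; rewrite ?mulmx1 // mul1r mulr1. Qed.

Lemma scalarM A B : scalar_mat A -> scalar_mat B -> scalar_mat (A * B).
Proof.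
move=> [sA cA] [sB cB]; split=> [v w|C sC].
  by rewrite -mulmxE !mulmxA sB sA -!mulmxA; congr (form v (w *m _)); apply: cB.
by rewrite -mulrA cB // mulrA cA // mulrA.
Qed.

Lemma scalar_comm A B : scalar_mat A -> scalar_mat B -> A * B = B * A.
Proof. by move=> [_ cA] [sB _]; apply: cA. Qed.

Lemma scalar_scalar_mx a : scalar_mat a%:M.
Proof.
rewrite (_ : a%:M = 1 *~ a).
  exact: (subgroupMz subgroup_scalar _ scalar1).
by rewrite -scaler_int intz scalemx1.
Qed.

Section Frame.
Variable x : 'I_n -> R.
Let X : 'M[int]_n := \matrix_i k (x i).
Hypothesis X0 : \det X != 0.

Let Xx i : k (x i) = row i X. Proof. by rewrite rowK. Qed.

(** The images of the basis [b] given by the second clause define [A]; that [A]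
    maps [x i] to [y i] follows from the first clause by nondegeneracy. *)
Lemma adj_codeP y : adj_code N x y <->
  exists2 A, selfadj A & forall i, k (y i) = k (x i) *m A.
Proof.
split=> [[yx yv]|[A sA yA]]; last first.
  split=> [ik|u]; first by rewrite !smulE !yA sA.
  by exists (s (k u *m A)) => i; rewrite !smulE !yA kb sA -sA.
have /choice[v vP] : forall i, exists v, forall l,
  f v (x l) = f (b i) (y l) /\ f (x l) v = f (y l) (b i) by move=> i; apply: yv.
pose A := \matrix_i k (v i).
have Al w l : form (w *m A) (k (x l)) = form w (k (y l)).
  rewrite mulmx_lincomb form_lincombl.
  rewrite -{2}(kb w) (raddf_lincomb k) form_lincombl.
  by apply: eq_lincomb => i /=; rewrite rowK -!smulE (vP i l).1.
have Ar w l : form (k (x l)) (w *m A) = form (k (y l)) w.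
  rewrite mulmx_lincomb raddf_lincomb /=.
  rewrite -{2}(kb w) (raddf_lincomb k) raddf_lincomb.
  by apply: eq_lincomb => i /=; rewrite rowK -!smulE (vP i l).2.
have yA i : k (y i) = k (x i) *m A.
  apply/eqP; rewrite -subr_eq0; apply/eqP/form_nondeg => w; split.
    move: w; apply: (form_rows X0) => l; rewrite -Xx formBl.
    by rewrite Al -!smulE (yx (i, l)) subrr.
  move: w; apply: (form_rowsl X0) => l.
  by rewrite -Xx raddfB /= Ar -!smulE (yx (l, i)) subrr.
exists A => // v' w; apply/eqP; rewrite -subr_eq0; apply/eqP; move: w.
apply: (additive_rows _ _ X0) => [u w|u|i]; last first.
- by rewrite -Xx Al -yA subrr.
- by eexists; rewrite -mulrnBl.
by rewrite mulmxBl !raddfB /= ?opprD ?opprK addrACA.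
Qed.

Lemma scalar_codeP y : scalar_code N x y <->
  exists2 A, scalar_mat A & forall i, k (y i) = k (x i) *m A.
Proof.
split=> [[/adj_codeP[A sA yA] yC]|[A [sA cA] yA]].
  exists A => //; split=> // B sB; apply: (selfadj_comm X0) => //.
  pose z i := s (k (x i) *m B).
  have zB i : k (z i) = k (x i) *m B by rewrite kb.
    have /adj_codeP zx :
      exists2 A, selfadj A & forall i, k (z i) = k (x i) *m A.
    by exists B.
  by move=> i l; have := yC z zx (i, l); rewrite !smulE /= !yA !zB !Xx.
split; first by apply/adj_codeP; exists A.
move=> z /adj_codeP[B sB zB] ik; rewrite !smulE !yA !zB.
by rewrite -!sB -!sA -!mulmxA !mulmxE cA.
Qed.

(** A self-adjoint matrix is determined by its form on the rows of [X], so its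
    membership in the ideal generated by the [J l] is a condition on values of
    the multiplication. *)
Lemma nil_codeP q (j : 'I_q -> 'I_n -> R) (J : 'I_q -> 'M_n) D y z :
  (forall l, scalar_mat (J l)) -> (forall l i, k (j l i) = k (x i) *m J l) ->
  selfadj D ->
  (forall i l, form (k (y i)) (k (z l)) = form (k (x i) *m D) (k (x l))) ->
  nil_code N x j y z <->
  exists2 C : 'I_q -> 'M_n, forall l, scalar_mat (C l) & D = \sum_l J l * C l.
Proof.
move=> sJ jJ sD yz.
have formS (C : 'I_q -> 'M_n) i m : (forall l, scalar_mat (C l)) ->
    \sum_l form (k (x i) *m J l) (k (x m) *m C l) =
    form (k (x i) *m \sum_l J l * C l) (k (x m)).
  move=> sC; rewrite mulmx_sumr form_suml; apply: eq_bigr => l _.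
  by rewrite -(sC l).1 mulmxA.
split=> [[c [sc cE]]|[C sC DE]].
  have /choice[C CP] : forall l, exists C, scalar_mat C /\
      forall i, k (c l i) = k (x i) *m C.
    by move=> l; have /scalar_codeP[C sC cC] := sc l; exists C.
  have sC l : scalar_mat (C l) by case: (CP l).
  exists C => //; apply/eqP; rewrite -subr_eq0; apply/eqP.
  apply: (selfadj_eq0 X0).
    apply: subgroup_selfadj.2 => //.
    apply: (subgroup_sum subgroup_selfadj) => l _.
    by case: (scalarM (sJ l) (sC l)).
  move=> i m; rewrite mulmxBr formBl -!Xx -formS //.
  rewrite -yz -smulE (cE (i, m)) /=; apply/eqP; rewrite subr_eq0; apply/eqP.
  by apply: eq_bigr => l _; rewrite smulE jJ (CP l).2.
exists (fun l i => s (k (x i) *m C l)); split=> [l|[i m]] /=.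
  by apply/scalar_codeP; exists (C l) => // i; rewrite kb.
rewrite smulE yz DE -formS //; apply: eq_bigr => l _.
by rewrite smulE jJ kb.
Qed.

End Frame.
End Scalars.

Lemma subgroup_nilpotent n (P : 'M[int]_n -> Prop) : subgroup P ->
  (forall A B, P A -> P B -> A * B = B * A) ->
  subgroup (fun A => P A /\ exists m, A ^+ m = 0).
Proof.
move=> sP PC; split; first by split; [exact: sP.1|exists 1%N; rewrite expr1].
move=> A B [PA [m Am]] [PB [l Bl]]; split; first exact: sP.2.
have AB : GRing.comm A (- B) by rewrite /GRing.comm mulrN mulNr PC.
exists (m + l)%N; rewrite exprDn_comm //; apply: big1 => i _.
have [li|il] := leqP l i.
  by rewrite -(subnKC li) exprD exprNn Bl mulr0 mul0r mulr0 mul0rn.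
rewrite -addnBA ?(ltnW il) // exprD Am !mul0r mul0rn.
by [].
Qed.

Section RigidFrame.
Variables (R : naRingType) (N n : nat).
Hypothesis NT : forall x : R, torsion x -> x *+ N = 0.
Hypothesis N0 : (0 < N)%N.
Variables (k : {additive R -> 'rV[int]_n}) (b : 'I_n -> R).
Hypothesis kL : forall x, sann N x <-> k x = 0.
Hypothesis kb : forall v, k (lincomb b v) = v.

Local Notation sc := (scalar_mat N b).
Local Notation nilsc := (fun A => sc A /\ exists m, A ^+ m = 0).

Variables (r q : nat) (p : 'I_r -> 'M[int]_n) (j : 'I_q -> 'M[int]_n).
Hypotheses (sp : forall t, sc (p t))
  (pP : forall A, sc A -> exists c, A = lincomb p c).
Hypotheses (sj : forall l, nilsc (j l))
  (jP : forall A, nilsc A -> exists c, A = lincomb j c).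

Let scj l : sc (j l). Proof. by case: (sj l). Qed.

Let subgroup_nilsc : subgroup nilsc.
Proof.
by apply: subgroup_nilpotent; [exact: subgroup_scalar|exact: scalar_comm].
Qed.

(** The [j l] generate the nilradical even over the integers, and the nilradical
    is semiprime. *)
Lemma scalar_frame_basis : scalar_frame N b
  (fun t i => lincomb b (row i (p t))) (fun l i => lincomb b (row i (j l))).
Proof.
have kbi i : k (b i) = delta_mx 0 i by rewrite -[b i]lincomb_delta kb.
have bX0 : \det (\matrix_i k (b i)) != 0.
  rewrite (_ : \matrix_i _ = 1) ?det1 ?oner_neq0 //.
  by apply/row_matrixP => i; rewrite rowK row1.
have nilP (l : 'I_q) i : k (lincomb b (row i (j l))) = k (b i) *m j l.
  by rewrite kb kbi -rowE.
split=> [t|u|y /(scalar_codeP NT N0 kL kb bX0)[A sA yA]].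
- apply/(scalar_codeP NT N0 kL kb bX0); exists (p t) => // i.
  by rewrite kb kbi -rowE.
- exists (fun i l => b l *~ k u 0 i); split=> [i|].
    apply/(scalar_codeP NT N0 kL kb bX0); exists (k u 0 i)%:M.
      exact: scalar_scalar_mx.
    by move=> l; rewrite raddfMz mul_mx_scalar -scaler_int intz.
  by apply/kL; rewrite raddfB /= (kb (k u)) subrr.
have sAA : sc (A * A) by apply: scalarM.
move=> /(nil_codeP NT N0 kL kb bX0 scj nilP sAA.1)[i m|C sC AAE].
  by rewrite !yA -sA.1 -mulmxA.
apply/(nil_codeP NT N0 kL kb bX0 scj nilP sA.1) => [i m|]; first by rewrite yA.
have [_ [m AAm]] : nilsc (A * A).
  rewrite AAE; apply: (subgroup_sum subgroup_nilsc) => l _.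
  split; first exact: scalarM.
  have [_ [m jm]] := sj l; exists m.
  by rewrite exprMn_comm ?jm ?mul0r //; apply: scalar_comm.
have [|c ->] := jP (A := A).
  by split=> //; exists (m + m)%N; rewrite exprD -exprMn_comm.
exists (fun l => (c 0 l)%:M) => [l|]; first exact: scalar_scalar_mx.
apply: eq_bigr => l _.
by rewrite -mulmxE mul_mx_scalar -[in RHS](intz (c 0 l)) scaler_int.
Qed.

(** Here [X] is the matrix of an endomorphism, and [x], [p'], [j'] are the
    images of the tuples of [scalar_frame_basis]. The first clause of the frame
    shows that conjugation by [X] preserves the scalars, and the third one that
    the conjugates of the [j l] generate the nilradical, so conjugation is onto.
    The second clause then writes [v] as a combination of the rows of [X] with
    coefficients that can be moved to the other side of [X]. *)
Lemma scalar_frame_rigid x p' j' :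
  let X := \matrix_i k (x i) in \det X != 0 ->
  (forall t i, k (p' t i) = row i (p t *m X)) ->
  (forall l i, k (j' l i) = row i (j l *m X)) ->
  scalar_frame N x p' j' -> forall v : 'rV_n, exists w : 'rV_n, v = w *m X.
Proof.
move=> X X0 p'E j'E [sp' gen nil].
have Xx i : k (x i) = row i X by rewrite rowK.
have XP A : sc A -> exists2 B, sc B & A * X = X * B.
  move=> /pP[c ->]; pose D A := exists2 B, sc B & A * X = X * B.
  apply: (@subgroup_lincomb _ D).
    split.
      by exists 0; rewrite ?mul0r ?mulr0 //; apply: (subgroup_scalar N b).1.
    move=> A1 A2 [B1 s1 e1] [B2 s2 e2]; exists (B1 - B2).
      exact: (subgroup_scalar N b).2.
    by rewrite mulrBl mulrBr e1 e2.
  move=> t; have /(scalar_codeP NT N0 kL kb X0)[B sB pB] := sp' t.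
  exists B => //; apply/row_matrixP => i.
  by rewrite -!mulmxE -p'E pB Xx row_mul.
have /choice[J JP] : forall l, exists B, sc B /\ j l * X = X * B.
  by move=> l; have [B] := XP _ (scj l); exists B.
have sJ l : sc (J l) by case: (JP l).
have j'J l i : k (j' l i) = k (x i) *m J l.
  by rewrite j'E Xx -row_mul !mulmxE (JP l).2.
pose I A := exists2 C : 'I_q -> 'M_n, forall l, sc (C l) & A = \sum_l J l * C l.
(* [I] is the ideal generated by the conjugates of the [j l]. *)
have Isq A : sc A -> I (A * A) -> I A.
  move=> sA IAA; pose y i := lincomb b (k (x i) *m A).
  have yA i : k (y i) = k (x i) *m A by rewrite kb.
  have sAA : sc (A * A) by apply: scalarM.
  apply/(nil_codeP (y := y) (z := x) NT N0 kL kb X0 sJ j'J sA.1).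
    by move=> i l; rewrite yA.
  apply: nil; first by apply/(scalar_codeP NT N0 kL kb X0); exists A.
  apply/(nil_codeP NT N0 kL kb X0 sJ j'J sAA.1) => // i l.
  by rewrite !yA -sA.1 -mulmxA.
(* Taking square roots [m] times leads from the zero matrix [A ^+ (2 ^ m)] to
   [A]. *)
have Inil A m : sc A -> A ^+ m = 0 -> I A.
  move=> sA Am; have : I (A ^+ (2 ^ m)).
    exists (fun=> 0) => [l|]; first exact: (subgroup_scalar N b).1.
    rewrite big1 => [|l _]; last by rewrite mulr0.
    by rewrite -(subnK (ltnW (ltn_expl m (isT : (1 < 2)%N)))) exprD Am mulr0.
  elim: (m) => [|l IH]; first by rewrite expr1.
  rewrite expnS mul2n -addnn exprD => /Isq H; apply/IH/H.
  elim: (2 ^ l)%N => [|i]; rewrite ?expr0 ?exprS; first exact: scalar1.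
  exact: scalarM.
have onto := conjugation_onto (subgroup_scalar N b) (scalar1 N b)
  (@scalarM _ _ _ b) (@scalar_comm _ _ _ b) X0 XP scj (fun l => (sj l).2) sJ
  (fun l => (JP l).2) Inil.
move=> v; have [c [sc' /kL]] := gen (lincomb b v).
rewrite raddfB /= kb raddf_sum => /subr0_eq ->.
have /choice[B BP] : forall i, exists B, k (c i i) = row i B *m X.
  move=> i; have /(scalar_codeP NT N0 kL kb X0)[A sA cA] := sc' i.
  have [B _ BX] := onto _ sA; exists B.
  by rewrite cA Xx -!row_mul !mulmxE BX.
exists (\sum_i row i (B i)); rewrite mulmx_suml.
by apply: eq_bigr => i _.
Qed.
End RigidFrame.

(** The tuple of [scalar_frame_basis] works: by [scalar_frame_rigid], [rho] is
    onto modulo [sann]. As [N] times [sann] lies in the annihilator and [rho] is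
    onto modulo a multiple of [N], it is onto modulo the annihilator. *)
Lemma rigid_tuple (R : naRingType) : fg_group R ->
  exists (V : finType) (Q : forall T : naRingType, (V -> T) -> Prop)
      (x : V -> R) (N : nat),
    [/\ fo_rel Q, Q R x, (1 < N)%N
      & forall rho : {additive R -> R}, {morph rho : y z / (y * z)%g} ->
          onto_mod N rho -> Q R (rho \o x) ->
          forall u, exists w, Ann (u - rho w)].
Proof.
move=> fgR.
have fgT := fin_gen_torsion fgR.
have [N N0 NT] := torsion_exponent (subgroup0 R) fgT (fun x => id).
have smul_free (y z : R) (a : int) :
    a != 0 -> smul N y z *~ a = 0 -> smul N y z = 0.
  move=> a0 h; apply: NT; exists (N%:Z * a).
    by rewrite mulf_neq0 // (lt0r_neq0 (N0 : 0 < N%:Z)).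
  by rewrite mulrzA -pmulrn.
have ssann : subgroup (@sann N R).
  split=> [y|y z hy hz t]; first by rewrite /smul namul0r namulr0 mul0rn.
  rewrite /smul namulBl namulBr !mulrnBl.
  have := hy t; have := hz t; rewrite /smul => -[-> ->] [-> ->].
  by rewrite subr0.
have [|n [k [b [kL _ kb]]]] := free_quotient fgR ssann.
  move=> y a a0 hy z; have [h1 h2] := hy z.
  split; apply: (smul_free _ _ a) => //.
    by rewrite -h1 /smul namulMzl !pmulrn -!mulrzA mulrC.
  by rewrite -h2 /smul namulMzr !pmulrn -!mulrzA mulrC.
have fgsub (P : 'M[int]_n -> Prop) : subgroup P -> fin_gen P.
  by move=> sP; apply: fin_gen_subgroup sP (@fg_mx n n) _.
have [r [p [sp pP]]] := fgsub _ (subgroup_scalar N b).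
have [|q [j [sj jP]]] :=
  fgsub (fun A => scalar_mat N b A /\ exists m, A ^+ m = 0).
  by apply: subgroup_nilpotent; [exact: subgroup_scalar|exact: scalar_comm].
pose V : finType := ('I_n + ('I_r * 'I_n + 'I_q * 'I_n))%type.
pose Q (T : naRingType) (e : V -> T) := scalar_frame N
  (fun i => e (inl i)) (fun t i => e (inr (inl (t, i))))
  (fun l i => e (inr (inr (l, i)))).
pose x (v : V) := match v with
  | inl i => b i
  | inr (inl (t, i)) => lincomb b (row i (p t))
  | inr (inr (l, i)) => lincomb b (row i (j l))
  end.
exists V, Q, x, (N * 2)%N; split.
- exact: (@fo_scalar_frame N n r q V inl (fun t i => inr (inl (t, i)))
            (fun l i => inr (inr (l, i)))).
- exact: (scalar_frame_basis NT N0 kL kb sp sj jP).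
- by rewrite muln2 -addnn (leq_add N0 N0).
move=> rho rhoM rhoN Qrho.
have N1 : (1 < N * 2)%N by rewrite muln2 -addnn (leq_add N0 N0).
have rho_smul y z : rho (smul N y z) = smul N (rho y) (rho z).
  by rewrite raddfMn rhoM.
have [d d0 dP] := onto_mod_finite_index fgR N1 rhoN.
have rho_sann y : sann N y -> sann N (rho y).
  move=> hy z; have [w [a a0 zw]] := dP z; have [h1 h2] := hy w.
  have zE : z *~ (d * a) = rho (w *~ a).
    by rewrite mulrzA raddfMz; apply/eqP; rewrite -subr_eq0 -mulrzBl; apply/eqP.
  have da0 : d * a != 0 by rewrite mulf_neq0.
  have sMl (c : int) y1 z1 : smul N y1 z1 *~ c = smul N y1 (z1 *~ c) :> R.
    by rewrite /smul namulMzr !pmulrn -!mulrzA mulrC.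
  have sMr (c : int) y1 z1 : smul N y1 z1 *~ c = smul N (y1 *~ c) z1 :> R.
    by rewrite /smul namulMzl !pmulrn -!mulrzA mulrC.
  split; apply: (smul_free _ _ (d * a) da0).
    by rewrite sMl zE -rho_smul -sMl h1 mul0rz raddf0.
  by rewrite sMr zE -rho_smul -sMr h2 mul0rz raddf0.
have [|kh X0] := onto_mod_matrix kb _ N1 rhoN.
  by move=> y /kL/rho_sann/kL.
have onto := scalar_frame_rigid NT N0 kL kb pP sj X0 _ _ Qrho.
have {}onto u : exists w, sann N (u - rho w).
  have [||v vE] := onto _ _ (k u).
  - by move=> t i; rewrite /= kh kb row_mul.
  - by move=> l i; rewrite /= kh kb row_mul.
  by exists (lincomb b v); apply/kL; rewrite raddfB /= kh kb -vE subrr.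
move=> u; have [w [z ->]] := rhoN u; have [w' zw'] := onto z.
exists (w + w' *+ (N * 2)) => y.
rewrite raddfD raddfMn opprD addrACA subrr add0r -mulrnBl mulrnA.
have [h1 h2] := zw' y.
by rewrite !namulMnl !namulMnr -!/(smul _ _ _) h1 h2 mul0rn.
Qed.

(** * Annihilator, square and regularity *)

Lemma FDZ_fg_group (R : naRingType) : is_FDZ R -> fg_group R.
Proof.
move=> [m [s sR]]; exists m, (fun i => s`_i); split=> // x _.
have [a ->] := sR x; exists (\row_i a i).
by apply: eq_bigr => i _; rewrite mxE.
Qed.

Section Square.
Variable R : naRingType.

Lemma subgroup_Ann : subgroup (@Ann R).
Proof.
split=> [y|x x' hx hx' y]; first by rewrite namul0r namulr0.
rewrite namulBl namulBr.
by have [-> ->] := hx y; have [-> ->] := hx' y; rewrite subrr.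
Qed.

Lemma Rsquare_mul (x y : R) : Rsquare (x * y)%g.
Proof. by move=> I [_ IP]; apply: IP; exists x => //; exists y. Qed.

Lemma subgroup_Rsquare : subgroup (@Rsquare R).
Proof.
split=> [I [[[I0 _] _] _]|x y Rx Ry I II]; first by move: I0; rewrite inE.
have [[[_ IB] _] _] := II.
by have := IB x y; rewrite !inE; apply; [apply: Rx|apply: Ry].
Qed.

Lemma Rsquare_min (D : R -> Prop) : subgroup D -> (forall x y, D (x * y)%g) ->
  forall x, Rsquare x -> D x.
Proof.
move=> sD DM x; apply; split; last by move=> _ [y _ [z _ <-]]; apply: DM.
split=> //; split=> [|y z]; rewrite !inE; first exact: sD.1.
exact: sD.2.
Qed.

Lemma subgroup_Is (D : R -> Prop) : subgroup D -> subgroup (Is D).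
Proof.
move=> sD; split; first by exists 1; rewrite ?mul0rz //; apply: sD.1.
move=> x y [a a0 xa] [c c0 yc]; exists (a * c); first by rewrite mulf_neq0.
rewrite mulrzBl mulrzA [a * c]mulrC mulrzA.
by apply: sD.2; apply: subgroupMz.
Qed.

(** When [g] generates the ring, every element of the square is a sum of left
    multiples, one for each member of [g]: this makes the square definable. *)
Definition left_span m (g : 'I_m -> R) (x : R) : Prop :=
  exists z : 'I_m -> R, x = \sum_i (g i * z i)%g.

Lemma subgroup_left_span m (g : 'I_m -> R) : subgroup (left_span g).
Proof.
split; first by exists (fun=> 0); rewrite big1 // => i _; rewrite namulr0.
move=> _ _ [z ->] [z' ->]; exists (fun i => z i - z' i).
by rewrite -sumrB; apply: eq_bigr => i _; rewrite namulBr.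
Qed.

Lemma Rsquare_left_span m (g : 'I_m -> R) :
  (forall x, exists c, Ann (x - lincomb g c)) ->
  forall x, Rsquare x -> left_span g x.
Proof.
move=> gR; apply: Rsquare_min; first exact: subgroup_left_span.
move=> x y; have [c Ax] := gR x; exists (fun i => y *~ c 0 i).
have := (Ax y).1; rewrite namulBl => /subr0_eq ->; rewrite namul_lincombl.
by apply: eq_bigr => i _; rewrite namulMzr.
Qed.

Lemma left_span_Rsquare m (g : 'I_m -> R) x : left_span g x -> Rsquare x.
Proof.
move=> [z ->]; apply: (subgroup_sum subgroup_Rsquare) => i _.
exact: Rsquare_mul.
Qed.

End Square.

(** [F] is the part of [R] that corresponds to the first factor, so [R / F] is
    isomorphic to the addition [R0]. An annihilating element is the sum of an
    element of [R0] and one of [Is Rsquare], and the latter lies in [F] because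
    [R / F] is torsion-free. Therefore [R0] maps onto the second factor, that is
    to say onto a copy of itself; such a map is injective, and this excludes an
    annihilating element of [F] with a nonzero component in [R0]. *)
Lemma regular_split (R : naRingType) : fg_group R -> is_regular R ->
  exists F : R -> Prop,
    [/\ subgroup F, forall x y, F (x * y)%g,
        forall x (a : int), a != 0 -> F (x *~ a) -> F x,
        forall x, exists2 u, Ann u & F (x - u)
      & forall x, Ann x -> F x -> Is (@Rsquare R) x].
Proof.
move=> fgR [R0 [RF [[_ R0A R0I R0D] _ [g [gM [g' gK g'K]]]]]].
have R0_mul (c d : subring_type R0) : (c * d)%g = 0.
  apply: val_inj; rewrite subring_valM raddf0.
  have c0 : subring_set R0 (val c) by have := valP c; rewrite inE.
  exact: (R0A _ c0 (val d)).1.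
have R0_free (c : subring_type R0) (a : int) : a != 0 -> c *~ a = 0 -> c = 0.
  move=> a0 ca; apply: val_inj; rewrite raddf0.
  have c0 : subring_set R0 (val c) by have := valP c; rewrite inE.
  suff : [set 0]%classic (val c) by [].
  rewrite -R0I; split=> //; split; last exact: R0A.
  exists a => //; rewrite -raddfMz ca raddf0; exact: (subgroup_Rsquare R).1.
pose p x := (g x).2.
have pB : zmod_morphism p by move=> x y; rewrite /p raddfB.
pose P := HB.pack_for {additive R -> subring_type R0} p
            (GRing.isZmodMorphism.Build R (subring_type R0) p pB).
have g'A c : Ann (g' (0, c)).
  move=> y; split; apply: (can_inj gK); rewrite gM g'K raddf0;
    case: (g y) => y1 y2; congr pair; rewrite ?R0_mul //.
    exact: namul0r.
  exact: namulr0.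
have FM x y : p (x * y)%g = 0 by rewrite /p gM; apply: R0_mul.
have sF : subgroup (fun x => p x = 0).
  split=> [|x y px py]; rewrite -[p]/(P : _ -> _) ?raddf0 //.
  by rewrite raddfB /= px py subr0.
exists (fun x => p x = 0); split=> // [x a a0|x|x Ax Fx].
- by rewrite -[p]/(P : _ -> _) raddfMz => /R0_free->.
- exists (g' (0, p x)) => //.
  by rewrite -[p]/(P : _ -> _) raddfB /= /p g'K subrr.
have IF y : Is (@Rsquare R) y -> p y = 0.
  move=> [a a0 ya]; apply: (R0_free _ a a0); rewrite -[p]/(P : _ -> _) -raddfMz.
  exact: (Rsquare_min sF FM).
pose h (c : subring_type R0) := p (val c).
have hB : zmod_morphism h.
  by move=> c d; rewrite /h raddfB -[p]/(P : _ -> _) raddfB.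
pose H := HB.pack_for {additive subring_type R0 -> subring_type R0} h
            (GRing.isZmodMorphism.Build _ _ h hB).
have h_onto : onto_mod 2 H.
  move=> c; have [y [z [R0y [Iz _] yz]]] := R0D _ (g'A c).
  have y0 : y \in subring_set R0 by rewrite inE.
  exists (Sub y y0), 0; rewrite mul0rn addr0 /= /h SubK.
  transitivity (p (g' (0, c))); first by rewrite /p g'K.
  by rewrite yz -[p]/(P : _ -> _) raddfD /= (IF z) // addr0.
have fgR0 : fg_group (subring_type R0).
  have [m [e [_ eR]]] := fgR; exists m, (fun i => P (e i)); split=> // c _.
  have [//|a aE] := eR (g' (0, c)); exists a.
  by rewrite -[RHS](raddf_lincomb P) -aE /= /p g'K.
have [y [z [R0y [Iz Az] yz]]] := R0D _ Ax.
have y0 : y \in subring_set R0 by rewrite inE.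
suff : (Sub y y0 : subring_type R0) = 0.
  by move=> /(congr1 val); rewrite SubK raddf0 => y00; rewrite yz y00 add0r.
have [|a a0 ya] := onto_mod_ker fgR0 (isT : (1 < 2)%N) h_onto (x := Sub y y0).
  rewrite /= /h SubK; move: Fx.
  rewrite yz -[p]/(P : _ -> _) raddfD /= (IF z) //.
  by rewrite addr0.
exact: R0_free a0 ya.
Qed.

(** * Isomorphism *)

Lemma holds_iso (R S : naRingType) (f : {additive R -> S}) :
  {morph f : x y / (x * y)%g} -> bijective f ->
  forall p (e : nat -> R), holds e p <-> holds (f \o e) p.
Proof.
move=> fM [g gK fK].
have eval_f (e : nat -> R) t : eval (f \o e) t = f (eval e t).
  by elim: t => //= [|t -> u ->|t -> u ->]; rewrite ?raddf0 ?raddfD ?fM.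
have upd (e : nat -> R) i x :
    f \o [eta e with i |-> x] = [eta f \o e with i |-> f x].
  by apply/funext => l /=; case: eqP.
elim=> [t u||p IH|p IHp q IHq|p IHp q IHq|p IHp q IHq|i p IH|i p IH] e //=.
- by rewrite !eval_f; split=> [->//|/(can_inj gK)].
- by rewrite IH.
- by rewrite IHp IHq.
- by rewrite IHp IHq.
- by rewrite IHp IHq.
- split=> H x; first by have /IH := H (g x); rewrite upd fK.
  by apply/IH; rewrite upd.
- split=> -[x Hx]; first by exists (f x); rewrite -upd; apply/IH.
  by exists (g x); apply/IH; rewrite upd fK.
Qed.

Lemma iso_elem_equiv (R S : naRingType) : na_isomorphic R S -> elem_equiv R S.
Proof.
move=> [f [fM fbij]] p _; rewrite /models (holds_iso fM fbij).
by rewrite (_ : f \o _ = fun=> 0) //; apply/funext => i /=; rewrite raddf0.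
Qed.

Lemma injective_onto_isomorphic (R S : naRingType) (h : {additive R -> S}) :
  {morph h : x y / (x * y)%g} -> (forall x, h x = 0 -> x = 0) ->
  (forall y, exists x, h x = y) -> na_isomorphic R S.
Proof.
move=> hM hI /choice[g gK]; exists h; split=> //; exists g => // x.
by apply/eqP; rewrite -subr_eq0; apply/eqP/hI; rewrite raddfB /= gK subrr.
Qed.

Lemma onto_mod_injective (R S : zmodType) N (phi : {additive R -> S})
    (psi : {additive S -> R}) : fg_group R -> (1 < N)%N ->
  onto_mod N phi -> onto_mod N psi ->
  (forall x, torsion x -> phi x = 0 -> x = 0) -> forall x, phi x = 0 -> x = 0.
Proof.
move=> fgR N1 hphi hpsi tor x x0; apply: tor => //.
apply: (onto_mod_ker (h := psi \o phi : {additive R -> R}) fgR N1).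
  exact: (@onto_mod_comp _ _ _ _ psi phi).
by rewrite /= x0 raddf0.
Qed.

Lemma fo_reindex (V W : finType) (i : V -> W)
    (Q : forall T : naRingType, (V -> T) -> Prop) :
  fo_rel Q -> fo_rel (fun T (e : W -> T) => Q T (fun v => e (i v))).
Proof. by move=> fQ h; have [f fP] := fQ (h \o i); exists f. Qed.

(** In a ring where [left_span g] is the square and [b] kills the torsion modulo
    the square, this says that each annihilating element with a nonzero integer
    multiple in the square is congruent to some [h i] modulo the square. *)
Definition sq_code (b : nat) m w (T : naRingType)
    (g : 'I_m -> T) (h : 'I_w -> T) : Prop :=
  forall u, (forall y, (u * y)%g = 0 /\ (y * u)%g = 0) ->
    left_span g (u *+ b) -> exists i, left_span g (u - h i).

Lemma fo_left_span m (V : finType) (g : 'I_m -> V)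
    (t : forall T : naRingType, (V -> T) -> T) : fo_term t ->
  fo_rel (fun T e => left_span (fun i => e (g i)) (t T e)).
Proof.
move=> ft; apply: fo_exists; apply: fo_eq.
  by move=> h; apply: (ft (h \o inl)).
by apply: fo_sum => i; apply: fo_mul; apply: fo_var.
Qed.

Lemma fo_sq_code b m w (V : finType) (g : 'I_m -> V) (h : 'I_w -> V) :
  fo_rel (fun T e => sq_code b (fun i => e (g i)) (fun i => e (h i))).
Proof.
apply: fo_forall1; apply: fo_imp.
  apply: fo_forall1.
  by apply: fo_and; apply: fo_eq; (try exact: fo_zero); apply: fo_mul;
    apply: fo_var.
apply: fo_imp.
  apply: (fo_left_span (fun i => inl (g i))).
  by apply: fo_muln; apply: fo_var.
apply: fo_exists_fin => i.
apply: (fo_left_span (fun i => inl (g i))).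
by apply: fo_add; [|apply: fo_opp]; apply: fo_var.
Qed.

(** The homomorphism [phi] transfers a rigid tuple, and [psi] transfers the
    image of that tuple back to [R]. As [psi \o phi] is onto modulo the
    annihilator and [psi] is injective, [phi] is onto modulo the annihilator.

    For the last clause the number [b] is an exponent for [S], where the
    property is used; in [R] the representatives [h] do for every positive [b],
    so the property can be transferred without knowing a bound valid in both
    rings. *)
Lemma elem_equiv_embedding (R S : naRingType) : fg_group R -> fg_group S ->
  elem_equiv R S ->
  exists (N : nat) (phi : {additive R -> S}),
    [/\ (1 < N)%N, {morph phi : x y / (x * y)%g} /\ onto_mod N phi,
        forall x, phi x = 0 -> x = 0,
        forall s, exists r, Ann (s - phi r)
      & forall u, Ann u -> Is (@Rsquare S) u ->
          exists2 v, Ann v /\ Is (@Rsquare R) v & Rsquare (u - phi v)].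
Proof.
move=> fgR fgS RS.
have [V1 [Q1 [x1 [N [fQ1 Q1x N1 rigid]]]]] := rigid_tuple fgR.
have [m [g [_ gR]]] := fgR.
have gA x : exists c, Ann (x - lincomb g c).
  by have [//|c ->] := gR x; exists c; rewrite subrr; apply: (subgroup_Ann R).1.
have sIS := subgroup_Is (subgroup_Rsquare S).
have [b b0 bS] := torsion_exponent (subgroup_Rsquare S)
  (fin_gen_subgroup sIS fgS (fun _ _ => I)) (fun x => id).
pose D (x : R) := Ann x /\ Is (@Rsquare R) x.
have sD : subgroup D.
  have sI := subgroup_Is (subgroup_Rsquare R); have sA := subgroup_Ann R.
  split; first by split; [exact: sA.1|exact: sI.1].
  by move=> x y [? ?] [? ?]; split; [exact: sA.2|exact: sI.2].
have fgD := fin_gen_subgroup sD fgR (fun _ _ => I).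
have [c c0 cD] := torsion_exponent (subgroup_Rsquare R) fgD (fun x Dx => Dx.2).
have [w [h [Dh hD]]] := finite_mod sD fgD c0.
pose V : finType := (V1 + ('I_m + 'I_w))%type.
pose Q (T : naRingType) (e : V -> T) := Q1 T (fun v => e (inl v)) /\
  sq_code b (fun i => e (inr (inl i))) (fun i => e (inr (inr i))).
have fQ : fo_rel Q.
  apply: fo_and; first exact: fo_reindex.
  exact: (fo_sq_code b (fun i => inr (inl i)) (fun i => inr (inr i))).
pose x (v : V) := match v with
  | inl v => x1 v | inr (inl i) => g i | inr (inr i) => h i end.
have Qx : Q R x.
  split=> // u uA /left_span_Rsquare ub.
  have [|i [z [Dz uE]]] := hD u.
    by split=> //; exists b%:Z; rewrite -?pmulrn // -lt0n.
  exists i; apply: Rsquare_left_span => //=.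
  by rewrite uE addrAC subrr add0r; apply: cD.
have [phi [phiM [Q1phi sqphi] phiN phiT]] :=
  elem_equiv_transfer fgR RS fQ Qx (ltnW N1).
have SR : elem_equiv S R by move=> p sp; split=> /(RS p sp).
have [psi [psiM Q1psi psiN psiT]] :=
  elem_equiv_transfer fgS SR fQ1 Q1phi (ltnW N1).
have phiI := onto_mod_injective fgR N1 phiN psiN phiT.
have psiI := onto_mod_injective fgS N1 psiN phiN psiT.
have rhoA := rigid (psi \o phi : {additive R -> R}) _
  (onto_mod_comp psiN phiN) Q1psi.
have phiA s : exists r, Ann (s - phi r).
  have [|r rA] := rhoA _ (psi s); first by move=> y z; rewrite /= phiM psiM.
  exists r => y; have [h1 h2] := rA (psi y).
  by split; apply: psiI; rewrite psiM raddfB /= ?h1 ?h2.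
exists N, phi; split=> // u uA uI.
have [|i ui] := sqphi u uA.
  apply: Rsquare_left_span; last exact: bS.
  move=> s; have [r rA] := phiA s; have [//|d rE] := gR r.
  by exists d; rewrite (_ : lincomb _ d = phi r) // rE raddf_lincomb.
by exists (h i); [exact: Dh|exact: left_span_Rsquare ui].
Qed.

(** With [G] the image of [F], the quotients [R / F] and [S / G] are free, and
    their bases lift to the annihilators. The ranks agree because [phi] induces
    a map [W] between the quotients that is injective and onto modulo [N]. The
    isomorphism is [phi] on [F] and maps the lifted bases to each other; it is
    multiplicative because all products lie in [F] and do not see the
    annihilators. *)
Lemma regular_elem_equiv_iso (R S : naRingType) : fg_group R -> fg_group S ->
  is_regular R -> elem_equiv R S -> na_isomorphic R S.
Proof.
move=> fgR fgS regR RS.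
have [F [sF FM Ffree FA FI]] := regular_split fgR regR.
have [N [phi [N1 [phiM phiN] phiI phiA phiS]]] :=
  elem_equiv_embedding fgR fgS RS.
have phi_Ann v : Ann v -> Ann (phi v).
  move=> vA s; have [r rA] := phiA s.
  have -> : s = phi r + (s - phi r) by rewrite subrKC.
  rewrite namulDl namulDr -!phiM (vA r).1 (vA r).2 raddf0 !add0r.
  by split; [exact: (rA _).2|exact: (rA _).1].
pose G y := exists2 x, F x & y = phi x.
have sG : subgroup G.
  split; first by exists 0; rewrite ?raddf0 //; apply: sF.1.
  move=> _ _ [x Fx ->] [y Fy ->].
  by exists (x - y); [exact: sF.2|rewrite raddfB].
have GA s : exists2 u, Ann u & G (s - u).
  have [r rA] := phiA s; have [v vA Fv] := FA r; exists (phi v + (s - phi r)).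
    exact: (subgroupD (subgroup_Ann S) (phi_Ann _ vA) rA).
  by exists (r - v); rewrite // raddfB /= opprD addrCA opprB subrKC addrC.
have GM x y : G (x * y)%g.
  have [u uA [r Fr xu]] := GA x; have [v vA [t Ft yv]] := GA y.
  exists (r * t)%g => //; rewrite phiM -xu -yv namulBl !namulBr.
  by rewrite (uA y).1 (uA v).1 (vA x).2 !subr0.
have Gsq := Rsquare_min sG GM.
have Gfree x (a : int) : a != 0 -> G (x *~ a) -> G x.
  move=> a0 [t Ft xt]; have [u uA [r Fr xu]] := GA x.
  (* The multiple of [u] is an annihilating element of the image of [F]. *)
  suff Gu : G u by rewrite -(subrK u x); apply: (subgroupD sG) => //; exists r.
  have uE : u *~ a = phi (t - r *~ a).
    by rewrite raddfB raddfMz /= -xt -xu mulrzBl opprB subrKC.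
  have [||c c0 tc] := FI (t - r *~ a).
  - move=> y; split; apply: phiI; rewrite phiM -uE.
      by rewrite namulMzl (uA _).1 mul0rz.
    by rewrite namulMzr (uA _).2 mul0rz.
  - by apply: sF.2 => //; apply: subgroupMz.
  have [|v [_ [d d0 vd]] uv] := phiS u uA.
    exists (a * c); first by rewrite mulf_neq0.
    rewrite mulrzA uE -raddfMz.
    apply: (@Rsquare_min R (fun x => Rsquare (phi x))) tc.
      split; first by rewrite raddf0; apply: (subgroup_Rsquare S).1.
      by move=> y z ? ?; rewrite raddfB; apply: (subgroup_Rsquare S).2.
    by move=> y z; rewrite phiM; apply: Rsquare_mul.
  rewrite -(subrK (phi v) u); apply: (subgroupD sG); first exact: Gsq.
  by exists v => //; apply: (Ffree _ d) => //; apply: (Rsquare_min sF FM).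
have [n [k [b [kF kb kbK]]]] := free_quotient fgR sF Ffree.
have [n' [l [b' [lG lb lbK]]]] := free_quotient fgS sG Gfree.
have lphi x : F x -> l (phi x) = 0 by move=> Fx; apply/lG; exists x.
have /choice[u uP] : forall i, exists u, Ann u /\ k u = delta_mx 0 i.
  move=> i; have [u uA] := FA (b i); rewrite kF raddfB /= kb => /subr0_eq ui.
  by exists u.
have /choice[u' uP'] : forall i, exists u, Ann u /\ l u = delta_mx 0 i.
  move=> i; have [v vA] := GA (b' i); rewrite lG raddfB /= lb => /subr0_eq vi.
  by exists v.
have ku v : k (lincomb u v) = v.
  rewrite raddf_lincomb [RHS]row_sum_delta; apply: eq_bigr => i _ /=.
  by rewrite (uP i).2 -[in RHS](intz (v 0 i)) scaler_int.
have lu' v : l (lincomb u' v) = v.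
  rewrite raddf_lincomb [RHS]row_sum_delta; apply: eq_bigr => i _ /=.
  by rewrite (uP' i).2 -[in RHS](intz (v 0 i)) scaler_int.
have uA v : Ann (lincomb u v).
  by apply: (subgroup_lincomb (subgroup_Ann R)) => i; case: (uP i).
have uA' v : Ann (lincomb u' v).
  by apply: (subgroup_lincomb (subgroup_Ann S)) => i; case: (uP' i).
have Fu x : F (x - lincomb u (k x)) by rewrite kF raddfB /= ku subrr.
pose W := \matrix_i l (phi (u i)).
have lW v : l (phi (lincomb u v)) = v *m W.
  rewrite mulmx_lincomb !raddf_lincomb; apply: eq_lincomb => i /=.
  by rewrite rowK.
have lphiW x : l (phi x) = k x *m W.
  by rewrite -lW; apply/eqP; rewrite -subr_eq0 -!raddfB; apply/eqP/lphi.
have nn' : n = n'.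
  have /choice[r /choice[z rz]] : forall i, exists r z, b' i = phi r + z *+ N.
    by move=> i; apply: phiN.
  apply: (@square_of_injective_onto_mod _ _ W N (\matrix_i k (r i))
           (- \matrix_i l (z i)) N1) => [v vW|].
    have /lG[x Fx /eqP] : l (phi (lincomb u v)) = 0 by rewrite lW.
    rewrite -subr_eq0 -raddfB => /eqP/phiI/subr0_eq xE.
    by rewrite -(ku v) xE; apply/kF.
  apply/row_matrixP => i; rewrite row_mul rowK -lphiW.
  transitivity (l (b' i) - l (z i) *+ N).
    by rewrite [in RHS]rz raddfD raddfMn addrK.
  apply/rowP => j; rewrite lb !(mxE, mulmxnE) eqxx.
  by rewrite [j == i]eq_sym mulNrn.
case: n' / nn' in l b' lG lb lbK lphi u' uP' lu' uA' W lW lphiW *.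
pose a x := x - lincomb u (k x).
have aB x y : a (x - y) = a x - a y.
  by rewrite /a !raddfB /= ?opprD ?opprK addrACA.
pose h x := phi (a x) + lincomb u' (k x).
have hB : zmod_morphism h.
  by move=> x y; rewrite /h aB !raddfB /= ?opprD ?opprK addrACA.
pose H := HB.pack_for {additive R -> S} h (GRing.isZmodMorphism.Build R S h hB).
have hP x : phi (a x) = h x - lincomb u' (k x) by rewrite addrK.
have lh x : l (h x) = k x by rewrite raddfD /= lu' lphi ?add0r //; apply: Fu.
apply: (@injective_onto_isomorphic _ _ H) => [x y|x hx|y] /=.
- have xyE : (x * y)%g = (a x * a y)%g.
    rewrite /a namulBl !namulBr.
    by rewrite (uA (k y) x).2 (uA (k x) y).1 (uA (k x) _).1 !subr0.
  rewrite {1}/h /a (kF _).1 // !raddf0 !addr0 xyE phiM !hP.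
  rewrite namulBl !namulBr.
  by rewrite (uA' (k y) _).2 (uA' (k x) _).1 (uA' (k x) _).1 !subr0.
- have kx : k x = 0 by rewrite -lh -[h x]/(H x) hx raddf0.
  by apply: phiI; rewrite -hx /= /h /a kx !raddf0 !addr0.
have /lG[x Fx xE] : l (y - lincomb u' (l y)) = 0 by rewrite raddfB /= lu' subrr.
exists (x + lincomb u (l y)).
have kx : k (x + lincomb u (l y)) = l y by rewrite raddfD /= ku (kF _).1 ?add0r.
by rewrite /h /a kx addrK -xE subrK.
Qed.

Theorem corollary1p6 (R : naRingType) (hR : is_FDZ R) (regR : is_regular R)
    (S : naRingType) (hS : is_FDZ S) :
  elem_equiv R S <-> na_isomorphic R S.
Proof.
split; last exact: iso_elem_equiv.
by apply: regular_elem_equiv_iso regR; apply: FDZ_fg_group.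
Qed.
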